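(* Let $\mathcal L$ be a countable relational language, $T$ a complete $\mathcal L$-theory with monster model $\mathcal U$ and small $M\prec\mathcal U$. Suppose $\mu=\sum_{i=1}^n r_i\delta_{q_i}$ where each $q_i\in S_x(\mathcal U)$ is $M$-invariant, $r_i\ge 0$, $\sum_{i=1}^n r_i=1$, and for each pair $1\le i,j\le n$ we have $q_i(x)\otimes q_j(y)=q_j(y)\otimes q_i(x)$. If $\mu$ does not concentrate on points, then there exists an $\mathcal L$-structure $N$ such that $\mathbb P_\mu(B_N)=1$.
   Context: $S_x(\mathcal U)$ is the space of complete global types. A type $q\in S_x(\mathcal U)$ is $M$-invariant if $\varphi(x,a)\in q\iff\varphi(x,b)\in q$ whenever $a\equiv_M b$. For $M$-invariant $q\in S_x(\mathcal U)$ and $s\in S_y(\mathcal U)$, the Morley product $q(x)\otimes s(y)$ is the type in $S_{xy}(\mathcal U)$ containing $\theta(x,y)$ iff $\theta(x,b)\in q$ for $b\models s|_{N'}$, where $N'\supseteq M$ is small and contains the parameters of $\theta$. $\delta_q$ is the Dirac measure at $q$. For $\mathbf x=(x_i)_{i\ge1}$, $\mathbb P_\mu$ is the regular Borel probability measure on $S_{\mathbf x}(\mathcal U)$ given by the iterated Morley product $\mu^{(1)}=\mu(x_1)$, $\mu^{(k+1)}=\mu(x_{k+1})\otimes\mu^{(k)}$; concretely $\mathbb P_\mu([\varphi(x_1,\dots,x_k)])=\sum_{(i_1,\dots,i_k)\in\{1,\dots,n\}^k}r_{i_1}\cdots r_{i_k}\,\mathbf 1[\varphi\in q_{i_k}(x_k)\otimes(\cdots\otimes(q_{i_2}(x_2)\otimes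 q_{i_1}(x_1)))]$, where $[\varphi]$ is the clopen set of types containing $\varphi$. $\mu$ does not concentrate on points if $\mu(x=a)=0$ for all $a\in\mathcal U$. For $p\in S_{\mathbf x}(\mathcal U)$, $p_{\mathcal L}$ is the isomorphism type of the substructure induced on $\{a_i:i\ge1\}$ for any realization $(a_i)$ of $p$ in an elementary extension of $\mathcal U$; $B_N=\{p\in S_{\mathbf x}(\mathcal U):p_{\mathcal L}\cong N\}$. *)

(* Defs.v *)
From HB Require Import structures.
From mathcomp Require Import all_boot all_order all_algebra.
From mathcomp Require Import all_classical all_reals all_analysis.

Set Implicit Arguments.
Unset Strict Implicit.
Unset Printing Implicit Defensive.

Import Order.TTheory GRing.Theory Num.Theory.
Local Open Scope classical_set_scope.
Local Open Scope ring_scope.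

(** * First-order logic over relational languages *)

Record language := Language { rel_symbol : Type; arity : rel_symbol -> nat }.

(* [formula L V]: the first-order L-formulas with equality whose free variables
   are in V. Under a quantifier the bound variable is [None]. An L_A-formula in
   the variables V is an element of [formula L (V + A)]: parameters are
   variables that will be interpreted by themselves. *)
Inductive formula (L : language) (V : Type) : Type :=
| FBot
| FEq of V & V
| FRel (s : rel_symbol L) of ('I_(arity s) -> V)
| FImp of formula L V & formula L V
| FAll of formula L (option V).

Arguments FBot {L V}.
Arguments FEq {L V} _ _.
Arguments FRel {L V} s _.

Definition FNot L (V : Type) (f : formula L V) : formula L V := FImp f FBot.

Fixpoint rename L (V W : Type) (h : V -> W) (f : formula L V) : formula L W :=
  match f with
  | FBot => FBot
  | FEq x y => FEq (h x) (h y)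
  | FRel s a => FRel s (h \o a)
  | FImp f1 f2 => FImp (rename h f1) (rename h f2)
  | FAll f1 => FAll (rename (omap h) f1)
  end.

Fixpoint free_vars_in L (V : Type) (D : V -> Prop) (f : formula L V) : Prop :=
  match f with
  | FBot => True
  | FEq x y => D x /\ D y
  | FRel s a => forall i, D (a i)
  | FImp f1 f2 => free_vars_in D f1 /\ free_vars_in D f2
  | FAll f1 => free_vars_in (fun x => if x is Some y then D y else True) f1
  end.

Record structure (L : language) := Structure {
  carrier :> Type;
  interp : forall s : rel_symbol L, ('I_(arity s) -> carrier) -> Prop;
  carrier_nonempty : [set: carrier] !=set0 }.

Fixpoint sat L (M : structure L) (V : Type) (f : formula L V) (v : V -> M) :
    Prop :=
  match f with
  | FBot => False
  | FEq x y => v x = v y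
  | FRel s a => interp (v \o a)
  | FImp f1 f2 => sat f1 v -> sat f2 v
  | FAll f1 => forall m : M, sat f1 (fun x => if x is Some y then v y else m)
  end.

Definition theory (L : language) := set (formula L void).

Definition models L (M : structure L) (T : theory L) :=
  forall f, T f -> sat f (of_void M).

Definition entails L (T : theory L) (f : formula L void) :=
  forall M : structure L, models M T -> sat f (of_void M).

Definition complete_theory L (T : theory L) :=
  (exists M : structure L, models M T) /\
  forall f, entails T f \/ entails T (FNot f).

Definition is_isomorphism L (M N : structure L) (g : M -> N) :=
  bijective g /\
  forall (s : rel_symbol L) (a : 'I_(arity s) -> M),
    interp (g \o a) <-> interp a.

Definition isomorphic L (M N : structure L) :=
  exists g : M -> N, is_isomorphism g.

Definition elementary_embedding L (M N : structure L) (e : M -> N) :=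
  forall k (f : formula L 'I_k) (v : 'I_k -> M), sat f (e \o v) <-> sat f v.

Section Substructure.
Context (L : language) (U : structure L) (A : set U) (A0 : A !=set0).

Lemma set_type_nonempty : [set: A] !=set0.
Proof. by case: A0 => x Ax; exists (SigSub (mem_set Ax)). Qed.

Definition substructure : structure L :=
  @Structure L A (fun s a => interp (set_val \o a)) set_type_nonempty.

End Substructure.

Definition elementary_substructure L (U : structure L) (M : set U) :=
  exists M0 : M !=set0,
    elementary_embedding (set_val : substructure M0 -> U).

(** * Types *)

Definition copair (X Y Z : Type) (f : X -> Z) (g : Y -> Z) (t : X + Y) : Z :=
  match t with inl x => f x | inr y => g y end.

Section Types.
Context (L : language) (U : structure L).

Definition pformula (V : Type) := formula L (V + U).

Definition psat (V : Type) (f : pformula V) (v : V -> U) : Prop :=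
  sat f (copair v id).

Definition over (A : set U) (V : Type) : set (pformula V) :=
  free_vars_in (copair (fun=> True) A).

Definition complete_type_over (A : set U) (V : Type) (p : set (pformula V)) :=
  [/\ p `<=` over A (V := V),
      (forall F : set (pformula V), finite_set F -> F `<=` p ->
         exists v : V -> U, forall f, F f -> psat f v) &
      forall f, over A f -> p f \/ p (FNot f)].

Record global_type (V : Type) := GlobalType {
  formulas_of :> set (pformula V);
  global_typeP : complete_type_over setT formulas_of }.

Definition realizes (V : Type) (p : set (pformula V)) (v : V -> U) :=
  forall f, p f -> psat f v.

Definition restriction (V : Type) (p : set (pformula V)) (A : set U) :
  set (pformula V) := p `&` over A (V := V).

Definition clopen_of (V : Type) (f : pformula V) : set (global_type V) :=
  [set p | formulas_of p f].

Lemma free_vars_inT (W : Type) (D : W -> Prop) (f : formula L W) :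
  (forall x, D x) -> free_vars_in D f.
Proof.
by elim: f D => //= {}W; [move=> f1 + f2 + D DT; split; auto
                         |move=> f IH D DT; apply: IH => -[]].
Qed.

Lemma tp_subproof (V : Type) (v : V -> U) :
  complete_type_over setT [set f : pformula V | psat f v].
Proof.
split=> [f _|F _ Fp|f _]; last by have [] := EM (psat f v); [left|right].
  by apply: free_vars_inT => -[].
by exists v => f /Fp.
Qed.

Definition tp (V : Type) (v : V -> U) : global_type V :=
  GlobalType (tp_subproof v).

End Types.

Section StoneSpace.
Context (L : language) (U : structure L) (V : Type).

HB.instance Definition _ := gen_eqMixin (formula L V).
HB.instance Definition _ := gen_choiceMixin (formula L V).
HB.instance Definition _ := isPointed.Build (formula L V) FBot.

HB.instance Definition _ := gen_eqMixin (global_type U V).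
HB.instance Definition _ := gen_choiceMixin (global_type U V).
HB.instance Definition _ :=
  isPointed.Build (global_type U V)
    (tp (fun=> sval (cid (carrier_nonempty U)))).

End StoneSpace.

(* The sets [clopen_of f] are closed under finite intersections, so they form
   a base. *)
HB.instance Definition _ (L : language) (U : structure L) (V : Type) :=
  isSubBaseTopological.Build (global_type U V)
    [set: formula L (V + U)] (@clopen_of L U V).

Notation borel T := (g_sigma_algebraType (@open T)).

Definition regular_measure (R : realType) (T : ptopologicalType)
    (P : set (borel T) -> \bar R) :=
  forall A : set (borel T), measurable A ->
    P A = ereal_inf (P @` [set O : set T | open O /\ A `<=` O]) /\
    P A = ereal_sup (P @` [set C : set T | compact C /\ C `<=` A]).

(** * Monster models *)

Section Monster.
Context (L : language) (K : Type) (U : structure L).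

(* |A| < |K| *)
Definition small (A : set U) : Prop := ~ ([set: K] #<= A)%card.

Definition saturated :=
  forall A : set U, small A ->
  forall k (p : set (pformula U 'I_k)), complete_type_over A p ->
  exists v, realizes p v.

Definition partial_elementary (A : set U) (g : U -> U) :=
  forall k (f : formula L 'I_k) (v : 'I_k -> U), (forall i, A (v i)) ->
    sat f (g \o v) <-> sat f v.

Definition strongly_homogeneous :=
  forall (A : set U) (g : U -> U), small A -> partial_elementary A g ->
  exists h : U -> U, is_isomorphism h /\ forall x, A x -> h x = g x.

(* The cardinal kappa is represented by a type K with |K| = kappa. For a
   countable language, kappa > |L| + aleph_0 says that K is uncountable. *)
Definition monster_model :=
  [/\ ~ countable [set: K], saturated & strongly_homogeneous].

End Monster.

(** * Invariant types, Morley products, and the measure P_mu *)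

Section Morley.
Context (L : language) (K : Type) (U : structure L) (M : set U).

Definition equiv_over k (a b : 'I_k -> U) :=
  forall f : pformula U 'I_k, over M f -> psat f a <-> psat f b.

Definition invariant_type (V : Type) (q : global_type U V) :=
  forall k (f : formula L (V + 'I_k)) (a b : 'I_k -> U), equiv_over a b ->
    formulas_of q (rename (copair inl (inr \o a)) f) <->
    formulas_of q (rename (copair inl (inr \o b)) f).

(* theta(x, b), for theta(x, y) with x in V and y in W *)
Definition inst (V W : Type) (b : W -> U) (f : pformula U (V + W)) :
    pformula U V :=
  rename (copair (copair inl (inr \o b)) inr) f.

(* The choice of N' and b is immaterial when q is an M-invariant type and s is
   a type. *)
Definition morley (V W : Type) (q : set (pformula U V))
    (s : set (pformula U W)) : set (pformula U (V + W)) :=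
  [set f | exists N' : set U, [/\ small K N', M `<=` N', over N' f &
     exists b : W -> U, realizes (restriction s N') b /\ q (inst b f)]].

(* q(x) ⊗ s(y) = s(y) ⊗ q(x): [morley s q] has y on the left, so the
   variables are swapped back. *)
Definition morley_commute (V W : Type) (q : set (pformula U V))
    (s : set (pformula U W)) :=
  morley q s =
  [set f |
    morley s q (rename (copair (copair (inl \o inr) (inl \o inl)) inr) f)].

Definition split_last k (j : 'I_k.+1) : unit + 'I_k :=
  if unlift ord_max j is Some i then inr i else inl tt.

(* q_k(x_k) ⊗ (... ⊗ (q_1(x_1) ⊗ q_0(x_0))); [split_last] makes x_k the
   variable of the left factor and x_0, ..., x_(k-1) those of the right one. *)
Fixpoint iterated_morley k :
    ('I_k.+1 -> global_type U unit) -> set (pformula U 'I_k.+1) :=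
  match k with
  | 0 => fun q =>
      [set f | formulas_of (q ord0) (rename (copair (fun=> inl tt) inr) f)]
  | k'.+1 => fun q =>
      [set f | morley (q ord_max)
                 (iterated_morley (fun i : 'I_k'.+1 => q (lift ord_max i)))
                 (rename (copair (inl \o @split_last k'.+1) inr) f)]
  end.

(* A formula in x_0, ..., x_k seen as a formula in the sequence (x_i)_i. *)
Definition in_seq k (f : pformula U 'I_k.+1) : pformula U nat :=
  rename (copair (fun j => inl (nat_of_ord j)) inr) f.

Definition mixture (R : realType) n (r : 'I_n -> R)
    (q : 'I_n -> global_type U unit) (A : set (borel (global_type U unit))) :
    \bar R :=
  (\sum_(i < n) (r i)%:E * \d_(q i : borel (global_type U unit)) A)%E.

Definition morley_measure (R : realType) n (r : 'I_n -> R)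
    (q : 'I_n -> global_type U unit)
    (P : probability (borel (global_type U nat)) R) :=
  regular_measure P /\
  forall k (f : pformula U 'I_k.+1),
    P (clopen_of (in_seq f)) =
    (\sum_(i : {ffun 'I_k.+1 -> 'I_n})
       (\prod_(j < k.+1) r (i j)) *
       (`[< iterated_morley (fun j => q (i j)) f >])%:R)%:E.

End Morley.

Section InducedStructure.
Context (L : language) (U : structure L).

Lemma range_nonempty (X : Type) (a : nat -> X) : range a !=set0.
Proof. by exists (a 0%N), 0%N. Qed.

(* p_L is isomorphic to N. The isomorphism type of the induced substructure
   does not depend on the extension W or on the realization a. *)
Definition B_ (N : structure L) : set (global_type U nat) :=
  [set p | exists (W : structure L) (e : U -> W) (a : nat -> W),
    [/\ elementary_embedding e,
        forall f, formulas_of p f -> sat f (copair a e) &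
        isomorphic (substructure (range_nonempty a)) N]].

End InducedStructure.

Arguments B_ {L} U N.

(* Main.v *)
Require Import Defs.
From mathcomp Require Import all_boot all_order all_algebra finmap.
From mathcomp Require Import all_classical all_reals all_analysis.

(** Call i a color. The measure is a mixture, over words w of colors of positive
    weight, of the types q_w = ... (x) q_(w 1) (x) q_(w 0). Finitely many formulas
    separate the distinct q_i, so almost every p reads off a word w from the
    one-variable formulas it contains, each color of positive weight occurs in w
    infinitely often, and p agrees with q_w on the atomic formulas. Because the
    q_i commute, a Morley sequence may be permuted together with its colors, and
    because the q_i are not realized, its elements are distinct; hence any two
    such p induce isomorphic structures, through a color-preserving bijection of
    the indices. Let N be the structure of one of them.

    That B_N is Borel needs no Scott analysis: "exchanging x and y is an
    automorphism" is an equivalence relation on N with finitely many classes,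
    all infinite, and any class-preserving bijection is an automorphism. So N is
    characterized by countably many quantifier-free conditions once
    representatives of the classes are chosen. *)

Set Implicit Arguments.
Unset Strict Implicit.
Unset Printing Implicit Defensive.

Local Open Scope classical_set_scope.

(** * Formulas and realizations of types *)

Section Formulas.
Context (L : language).

Lemma rename_comp (V W X : Type) (h : V -> W) (g : W -> X) (f : formula L V) :
  rename g (rename h f) = rename (g \o h) f.
Proof.
elim: f W X h g => {V} //= [V f IHf f' IHf'|V f IHf] W X h g.
  by rewrite IHf IHf'.
by rewrite IHf; congr (FAll (rename _ f)); apply: funext => -[].
Qed.

Lemma rename_id (V : Type) (f : formula L V) : rename id f = f.
Proof.
elim: f => {V} //= [V f -> f' -> //|V f IHf].
by rewrite [X in rename X](_ : _ = id) ?IHf//; apply: funext => -[].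
Qed.

Lemma free_vars_in_rename (V W : Type) (h : V -> W) (D : W -> Prop)
    (f : formula L V) :
  free_vars_in D (rename h f) = free_vars_in (D \o h) f.
Proof.
elim: f W h D => {V} //= [V f IHf f' IHf'|V f IHf] W h D.
  by rewrite IHf IHf'.
by rewrite IHf; congr (free_vars_in _ f); apply: funext => -[].
Qed.

Lemma sub_free_vars_in (V : Type) (D D' : V -> Prop) (f : formula L V) :
  (forall x, D x -> D' x) -> free_vars_in D f -> free_vars_in D' f.
Proof.
elim: f D D' => {V} //= [V x y|V s a|V f IHf f' IHf'|V f IHf] D D' DD'.
- by move=> [/DD' ? /DD'].
- by move=> Da i; exact/DD'/Da.
- by move=> [/(IHf _ _ DD') ? /(IHf' _ _ DD')].
- by apply: IHf => -[].
Qed.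

Lemma free_vars_in_and (V : Type) (D D' : V -> Prop) (f : formula L V) :
  free_vars_in D f -> free_vars_in D' f ->
  free_vars_in (fun x => D x /\ D' x) f.
Proof.
elim: f D D' => {V} //= [V x y|V f IHf f' IHf'|V f IHf] D D'.
- by move=> [? ?] [].
- by move=> [? ?] [? ?]; split; [exact: IHf|exact: IHf'].
- move=> Df D'f; have := IHf _ _ Df D'f; apply: sub_free_vars_in.
  by move=> -[].
Qed.

Lemma sat_rename (S : structure L) (V W : Type) (h : V -> W) (f : formula L V)
    (v : W -> S) :
  sat (rename h f) v <-> sat f (v \o h).
Proof.
elim: f W h v => {V} //= [V f IHf f' IHf'|V f IHf] W h v.
  by split=> ff' /IHf/ff'/IHf'.
suff E (m : S) : (fun x => if x is Some y then v y else m) \o omap h =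
    (fun x => if x is Some y then (v \o h) y else m).
  by split=> fA m; have := fA m; rewrite IHf E.
by apply: funext => -[].
Qed.

(** A formula mentions only finitely many variables. Invariance is stated for tuples indexed by
    ['I_k], and this brings formulas in arbitrary variables to that form. *)
Lemma rename_ord (V : Type) (D : V -> Prop) (f : formula L V) :
  free_vars_in D f ->
  exists m (c : 'I_m -> V) (f0 : formula L 'I_m),
    (forall i, D (c i)) /\ f = rename c f0.
Proof.
elim: f D => {V} [V|V x y|V s a|V f IHf f' IHf'|V f IHf] D /=.
- by move=> _; exists 0, (fun i : 'I_0 => False_rect V (ssrbool.notF (ltn_ord i))), FBot; split=> // -[].
- move=> [Dx Dy]; exists 2, (fun i => if i == ord0 then x else y), (FEq ord0 ord_max).
  by split=> // i; case: ifP.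
- by move=> Da; exists (arity s), a, (FRel s id).
- move=> [/IHf[m [c [f0 [Dc ->]]]] /IHf'[m' [c' [f0' [Dc' ->]]]]].
  exists (m + m')%N, (fun i => match fintype.split i with inl i => c i | inr i => c' i end),
    (FImp (rename (@lshift m m') f0) (rename (@rshift m m') f0')).
  split=> [i|/=]; first by case: fintype.split.
  rewrite !rename_comp; congr (FImp (rename _ f0) (rename _ f0')); apply: funext => i /=.
    by rewrite -[lshift _ _]/(unsplit (inl _)) unsplitK.
  by rewrite -[rshift _ _]/(unsplit (inr _)) unsplitK.
- move=> /IHf[m [c [f0 [Dc ->]]]].
  (* An element of [D] is the default where [c i] is [None]; if [D] is empty, every [c i] is [None]
     and the formula is closed. *)
  have [[v Dv]|noD] := EM (exists v, D v).
    exists m, (fun i => odflt v (c i)),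
      (FAll (rename (fun i => if c i is Some _ then Some i else None) f0)).
    split=> [i|/=]; first by have := Dc i; case: (c i).
    rewrite rename_comp; congr (FAll (rename _ f0)); apply: funext => i /=.
    by case E: (c i) => [x|] //=; rewrite E.
  exists 0, (fun i : 'I_0 => False_rect V (ssrbool.notF (ltn_ord i))),
    (FAll (rename (fun=> None) f0)).
  split=> [[]//|/=].
  rewrite rename_comp; congr (FAll (rename _ f0)); apply: funext => i /=.
  by have := Dc i; case: (c i) => //= v Dv; case: noD; exists v.
Qed.

End Formulas.

(** * Ultrapowers and the theorem of Łoś *)

Section Los.
Context (L : language) (U : structure L) (I : Type) (F : set_system I).
Context {FF : UltraFilter F}.

Let ueq (x y : I -> U) := F [set i | x i = y i].

Let ueq_sym x y : ueq x y -> ueq y x.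
Proof. by apply: filterS => i /= ->. Qed.

Let ueq_trans x y z : ueq x y -> ueq y z -> ueq x z.
Proof. by apply: filterS2 => i /= -> ->. Qed.

Let class_ueq x y : ueq x = ueq y <-> ueq x y.
Proof.
split=> [->|xy]; first by apply: filterE.
by apply: funext => z; apply: propext; split; apply: ueq_trans; [exact: ueq_sym|].
Qed.

(** The carrier is the set of [ueq]-classes, each kept as a predicate; [rep] chooses
    representatives, on which the relations of [W] are read. *)
Let T := {A : (I -> U) -> Prop | exists x, A = ueq x}.
Let pi (x : I -> U) : T := exist _ (ueq x) (ex_intro _ x erefl).
Let rep (w : T) : I -> U := sval (cid (svalP w)).

Let repK w : pi (rep w) = w.
Proof.
rewrite /rep; case: cid => x /=; case: w => A Ax /= E.
by move: Ax; rewrite {}E => Ax; congr exist; exact: Prop_irrelevance.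
Qed.

Let pi_eq x y : pi x = pi y <-> ueq x y.
Proof.
rewrite -class_ueq; split=> [[]//|xy]; rewrite /pi.
by move: (ex_intro _ x _); rewrite xy => ?; congr exist; exact: Prop_irrelevance.
Qed.

Let T_nonempty : [set: T] !=set0.
Proof. by have [u _] := carrier_nonempty U; exists (pi (fun=> u)). Qed.

Let W : structure L :=
  @Structure L T (fun s a => F [set i | interp (fun k => rep (a k) i)]) T_nonempty.

Let los (V : Type) (f : formula L V) (v : V -> I -> U) :
  sat f (pi \o v : V -> W) <-> F [set i | sat f (v^~ i)].
Proof.
have F0 : ~ F set0 by exact: filter_not_empty.
elim: f v => {V} /= [V|V x y|V s a|V f IHf f' IHf'|V f IHf] v.
- split=> // FF0; apply: F0; apply: filterS FF0 => //.
- exact: pi_eq.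
(* Arities are finite, so on a single set of [F] all chosen representatives agree with the given
   functions. *)
- have E : F [set i | forall k, rep (pi (v (a k))) i = v (a k) i].
    have := @filter_forall _ _ (fun k => [set i | rep (pi (v (a k))) i = v (a k) i]) F _.
    by apply=> k; have /pi_eq := repK (pi (v (a k))).
  by split; apply: (filterS2 _ _ E) => i /= Ei;
    rewrite (_ : (fun k => rep (pi (v (a k))) i) = (v^~ i \o a))//; apply: funext.
- split=> [ff'|Fff' /IHf Ff].
    have [Ff|nFf] := in_ultra_setVsetC [set i | sat f (v^~ i)] FF.
      by have /IHf/ff'/IHf' := Ff; apply: filterS => i /= ?.
    by apply: filterS nFf => i /= nsf sf; case: nsf.
  by apply/IHf'; apply: filterS2 Fff' Ff => i /= ff' /ff'.
- have E (m : I -> U) (m' : W) : m' = pi m ->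
     (fun x : option V => if x is Some y then (pi \o v) y else m') =
     pi \o (fun x : option V => if x is Some y then v y else m).
    by move=> ->; apply: funext => -[].
  split=> [fA|Ff m].
    set A := [set i | _].
    have [//|nA] := in_ultra_setVsetC A FF.
    (* Outside [A] take a counterexample to [f], inside [A] any element; the class of this function
       would refute the quantified formula in [W]. *)
    have /choice[m Hm] : forall i, exists m : U, (~ A i) ->
        ~ sat f (fun x => if x is Some y then v y i else m).
      move=> i; have [Ai|nAi] := EM (A i).
        by have [u _] := carrier_nonempty U; exists u.
      by have /existsNP[m Hm] := nAi; exists m.
    have := fA (pi m); rewrite (E m)// IHf => Ff.
    exfalso; apply: F0; apply: filterS2 Ff nA => i /= sf /Hm; apply.
    rewrite (_ : (fun x => _) = (fun x : option V => (if x is Some y then v y else m) i))//.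
    by apply: funext => -[].
  rewrite (E (rep m)) ?repK// IHf; apply: filterS Ff => i /= /(_ (rep m i)).
  rewrite (_ : (fun x => _) = (fun x : option V => (if x is Some y then v y else rep m) i))//.
  by apply: funext => -[].
Qed.

Lemma ultrapower : exists (W : structure L) (pi : (I -> U) -> W),
  forall (V : Type) (f : formula L V) (v : V -> I -> U),
  sat f (pi \o v) <-> F [set i | sat f (v^~ i)].
Proof. by exists W, pi. Qed.

End Los.

Section Realization.
Context (L : language) (U : structure L) (V : Type) (p : global_type U V).

Lemma global_type_realized : exists (W : structure L) (e : U -> W) (a : V -> W),
  elementary_embedding e /\ forall f, formulas_of p f <-> sat f (copair a e).
Proof.
have [_ pfin pcomp] := global_typeP p.
(* The ultraproduct is indexed by the assignments [V -> U] themselves: the sets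
   of assignments satisfying a finite part of [p] generate a proper filter. *)
pose F0 : set_system (V -> U) := [set S | exists2 F : set (pformula U V),
  finite_set F /\ F `<=` p & [set v | forall f, F f -> psat f v] `<=` S].
have F0P : ProperFilter F0.
  apply: Build_ProperFilter_ex.
    by move=> S [F [Ffin Fp] FS]; have [v Fv] := pfin F Ffin Fp; exists v; exact: FS.
  split; first by exists set0 => //; split=> [|? []]//; exact: finite_set0.
    move=> S S' [F [Ffin Fp] FS] [F' [Ffin' Fp'] FS'].
    exists (F `|` F'); first by rewrite finite_setU; split=> // f [/Fp|/Fp'].
    by move=> v Fv; split; [apply: FS|apply: FS'] => f Ff; apply: Fv; [left|right].
  by move=> S S' SS' [F FF FS]; exists F => // v /FS/SS'.
have [F [FF F0F]] := ultraFilterLemma F0P.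
have [W [pi los]] := @ultrapower L U _ F FF.
(* Elements of [U] become constant functions, and the variable [x] is realized by the evaluation
   [v |-> v x]. *)
exists W, (fun u => pi (fun=> u)), (fun x => pi (fun v => v x)); split.
  move=> k f v; rewrite (los _ f (fun x _ => v x)); split=> [|fv].
    have [//|nfv] := EM (sat f v); rewrite (_ : [set _ | _] = set0) => [/filter_not_empty//|].
    by apply/seteqP; split.
  exact: filterE.
have pP f : formulas_of p f -> sat f (copair (fun x => pi (fun v => v x))
    (fun u => pi (fun=> u))).
  move=> pf; have Ff : F [set v | psat f v].
    apply: F0F; exists [set f]; first by split=> [|_ ->//]; exact: finite_set1.
    by move=> v /(_ f erefl).
  have := los _ f (fun x v => copair v id x).
  rewrite (_ : pi \o _ = copair (fun x => pi (fun v => v x)) (fun u => pi (fun=> u))).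
    by move=> ->.
  by apply: funext => -[].
move=> f; split; first exact: pP.
have fT : Defs.over setT f by apply: free_vars_inT => -[].
by have [//|/pP/= nf /nf] := pcomp f fT.

Qed.

End Realization.

(** * Morley sequences *)

Lemma set_seq_cons (T : eqType) (x : T) (s : seq T) :
  [set` x :: s] = [set x] `|` [set` s].
Proof.
apply/seteqP; split=> y /=; first by rewrite inE => /predU1P.
by move=> yxs; rewrite inE; apply/predU1P.
Qed.

(** Hilbert's hotel: [h] shifts a sequence [s] of distinct elements of [A] by one place and sends
    [x] to [s 0]. *)
Lemma infinite_setU1_le (U : Type) (A : set U) (x : U) :
  infinite_set A -> (A `|` [set x] #<= A)%card.
Proof.
have [Ax _|nAx] := EM (A x).
  by rewrite (_ : A `|` [set x] = A) ?card_lexx//; apply/setUidPl => _ ->.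
move=> /infiniteP/card_leP/unsquash f.
have fA i : A (set_val (f (to_setT i))) by have := valP (f (to_setT i)); rewrite inE.
pose s i : U := set_val (f (to_setT i)).
have s_inj : injective s.
  by move=> i j /val_inj/(@inj _ _ _ f); rewrite !inE => /(_ I I)/(congr1 val).
pose h (y : U) : U := if pselect (exists i, y = s i) is left e then s (sval (cid e)).+1
  else if pselect (y = x) is left _ then s 0%N else y.
suff /Pinj[g gE] : {in A `|` [set x] &, injective h}.
  have := card_image g; rewrite card_eq_le => /andP[_ /card_le_trans]; apply.
  apply: subset_card_le => z [y Axy yz]; rewrite -yz -gE /h; case: pselect => [e|nsy]; first exact: fA.
  by case: pselect => [_|yx]; [exact: fA|case: Axy].
have nsx i : x <> s i by move=> xs; apply: nAx; rewrite xs; exact: fA.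
move=> y z _ _; rewrite /h.
case: (pselect (exists i, y = s i)) => [e|nsy];
  case: (pselect (exists i, z = s i)) => [e'|nsz].
- case: cid => i yi; case: cid => j zj /= /s_inj[ij].
  by rewrite yi zj ij.
- case: pselect => [_ /s_inj//|zx syz].
  by case: nsz; eexists; exact: esym syz.
- case: pselect => [_ /s_inj//|yx syz].
  by case: nsy; eexists; exact: syz.
case: (pselect (y = x)) => [->|yx]; case: (pselect (z = x)) => [->|zx]// sE.
  by case: nsz; exists 0%N.
by case: nsy; exists 0%N.
Qed.

Section Small.
Context (L : language) (K : Type) (U : structure L).
Hypothesis K_uncountable : ~ countable [set: K].

(** One more point does not change the size of an infinite set, and a finite set stays small because
    [K] is uncountable. *)
Lemma small_setU1 (A : set U) (x : U) : small K A -> small K (A `|` [set x]).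
Proof.
move=> sA KAx; have [Afin|Ainf] := EM (finite_set A).
  apply: K_uncountable; apply: sub_countable KAx _.
  by apply: finite_set_countable; rewrite finite_setU; split=> //; exact: finite_set1.
exact/sA/(card_le_trans KAx)/infinite_setU1_le.
Qed.

Lemma small_setU_image (A : set U) (c : nat -> U) (l : seq nat) :
  small K A -> small K (A `|` c @` [set` l]).
Proof.
elim: l A => [|i l IHl] A sA.
  by rewrite set_nil image_set0 setU0.
rewrite set_seq_cons image_setU image_set1 setUA; apply: IHl; exact: small_setU1.
Qed.

End Small.

Section MorleySequences.
Context (L : language) (K : Type) (U : structure L) (M : set U).
Hypothesis K_uncountable : ~ countable [set: K].
Hypothesis U_saturated : saturated K U.
Hypothesis M_nonempty : M !=set0.

(** The part of completeness used below. Iterated Morley products are plain sets of formulas, not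
    known beforehand to be types. *)
Definition deciding (V : Type) (s : set (pformula U V)) :=
  forall f, s f \/ s (FNot f).

Lemma global_type_deciding (V : Type) (p : global_type U V) : deciding p.
Proof.
move=> f; have [_ _ pd] := global_typeP p.
by apply: pd; apply: free_vars_inT => -[].
Qed.

Lemma overFNot (A : set U) (V : Type) (f : pformula U V) :
  Defs.over A f -> Defs.over A (FNot f).
Proof. by []. Qed.

Lemma sub_over (A A' : set U) (V : Type) (f : pformula U V) :
  A `<=` A' -> Defs.over A f -> Defs.over A' f.
Proof. by move=> AA'; apply: sub_free_vars_in => -[]. Qed.

Lemma realizesE (V : Type) (s : set (pformula U V)) (A : set U) (v : V -> U) f :
  deciding s -> realizes (restriction s A) v -> Defs.over A f ->
  s f <-> psat f v.
Proof.
move=> sd sv Af; split=> [sf|fv]; first exact: sv.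
have [//|sNf] := sd f.
by have /(_ fv) : psat (FNot f) v := sv _ (conj sNf (overFNot Af)).
Qed.

Lemma sub_realizes (V : Type) (s : set (pformula U V)) (A A' : set U) (v : V -> U) :
  A `<=` A' -> realizes (restriction s A') v -> realizes (restriction s A) v.
Proof. by move=> AA' sv f [sf Af]; apply: sv; split=> //; exact: sub_over Af. Qed.

Lemma small_over (A : set U) (V : Type) (f : pformula U V) : small K A ->
  exists A', [/\ small K A', A `<=` A' & Defs.over A' f].
Proof.
move=> sA; have [u0 _] := carrier_nonempty U.
have [|m [c [f0 [_ ->]]]] := @rename_ord L _ setT f; first exact: free_vars_inT.
pose d i : U := if insub i is Some j then copair (fun=> u0) id (c j) else u0.
exists (A `|` d @` [set` iota 0 m]); split; first exact: small_setU_image.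
  by move=> x; left.
rewrite /Defs.over free_vars_in_rename; apply: free_vars_inT => i /=.
case E: (c i) => [//|u]; right; exists (val i); first by rewrite /= mem_iota /=.
by rewrite /d valK E.
Qed.

(** The parameters of [f] lie in both [A] and [A'], so [b] and [b'], completed by these parameters,
    satisfy the same formulas over [M]: those that [s] dictates. Hence the Morley product does not
    depend on how it is tested. *)
Lemma inst_invariant (W : Type) (q : global_type U unit)
    (s : set (pformula U W)) (A A' : set U) (b b' : W -> U) f :
  invariant_type M q -> deciding s -> M `<=` A -> M `<=` A' ->
  Defs.over A f -> Defs.over A' f ->
  realizes (restriction s A) b -> realizes (restriction s A') b' ->
  formulas_of q (inst b f) -> formulas_of q (inst b' f).
Proof.
move=> qinv sd MA MA' Af A'f sb sb'; have [d Md] := M_nonempty.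
have [m [c [f0 [/all_and2[cA cA'] fE]]]] := rename_ord (free_vars_in_and Af A'f).
(* Slots that belong to the variable of [q] get the dummy value [d], taken in [M] so that no
   parameter outside [A] or [A'] appears. *)
pose bb (b : W -> U) (i : 'I_m) : U :=
  match c i with inl (inl _) => d | inl (inr w) => b w | inr u => u end.
pose F : formula L (unit + 'I_m) :=
  rename (fun i => if c i is inl (inl x) then inl x else inr i) f0.
have instE b0 : inst b0 f = rename (copair inl (inr \o bb b0)) F.
  rewrite /inst fE !rename_comp; congr (rename _ f0); apply: funext => i /=.
  by rewrite /bb; case E: (c i) => [[]|]; rewrite /= ?E.
rewrite !instE => /qinv; apply => g Mg.
pose G : pformula U W := rename (fun t => match t with
    inl i => match c i with inl (inl _) => inr d | inl (inr w) => inl w | inr u => inr u end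
  | inr u => inr u end) g.
have GE b0 : psat g (bb b0) <-> psat G b0.
  rewrite /psat sat_rename (_ : _ \o _ = copair (bb b0) id)//; apply: funext => -[i|//] /=.
  by rewrite /bb; case: (c i) => [[]|].
have GA A0 : M `<=` A0 -> (forall i, copair (fun=> True) A0 (c i)) -> Defs.over A0 G.
  move=> MA0 cA0; rewrite /Defs.over free_vars_in_rename; apply: sub_free_vars_in Mg.
  move=> -[i _|u /MA0//] /=.
  by have := cA0 i; case: (c i) => [[x|w]|u] //= _; exact/MA0/Md.
by rewrite !GE -(realizesE sd sb (GA _ MA cA)) (realizesE sd sb' (GA _ MA' cA')).
Qed.

Lemma over_inst (V W : Type) (A : set U) (b : W -> U) (f : pformula U (V + W)) :
  Defs.over A f -> Defs.over (A `|` range b) (inst b f).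
Proof.
rewrite /Defs.over free_vars_in_rename; apply: sub_free_vars_in => -[[]|] //= w.
  by right; exists w.
by left.
Qed.

Lemma psat_inst (V W : Type) (b : W -> U) (f : pformula U (V + W)) (a : V -> U) :
  psat (inst b f) a <-> psat f (copair a b).
Proof.
rewrite /psat sat_rename (_ : _ \o _ = copair (copair a b) id)//.
by apply: funext => -[[]|].
Qed.

Lemma morleyE (W : Type) (q : global_type U unit) (s : set (pformula U W))
    (A : set U) (b : W -> U) f :
  invariant_type M q -> deciding s -> small K A -> M `<=` A -> Defs.over A f ->
  realizes (restriction s A) b ->
  morley K M q s f <-> formulas_of q (inst b f).
Proof.
move=> qinv sd sA MA Af sb; split=> [[A' [_ MA' A'f [b' [sb' qf]]]]|qf].
  exact: (inst_invariant qinv sd MA' MA A'f Af sb' sb qf).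
by exists A; split=> //; exists b.
Qed.

(** The pair of [a] and [b] realizes [q1(x) ⊗ q2(y)] over [A], hence also [q2(y) ⊗ q1(x)]. The map
    [h] turns the parameter [a] of a formula into the variable of [q1], so that this can be
    applied. *)
Lemma realizes_swap (q1 q2 : global_type U unit) (A : set U) (a b : U) :
  invariant_type M q1 -> invariant_type M q2 -> morley_commute K M q1 q2 ->
  small K A -> M `<=` A ->
  realizes (restriction q2 A) (fun=> b) ->
  realizes (restriction q1 (A `|` [set b])) (fun=> a) ->
  realizes (restriction q2 (A `|` [set a])) (fun=> b).
Proof.
move=> q1inv q2inv q12 sA MA q2b q1a g [q2g Aag].
pose h (t : unit + U) : (unit + unit) + U := match t with inl _ => inl (inl tt)
  | inr u => if pselect (u = a) then inl (inr tt) else inr u end.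
pose sw : (unit + unit) + U -> (unit + unit) + U :=
  copair (copair (inl \o inr) (inl \o inl)) inr.
pose f := rename sw (rename h g).
have swf : rename sw f = rename h g.
  by rewrite /f rename_comp (_ : sw \o sw = id) ?rename_id//; apply: funext => -[[]|].
have hg : Defs.over A (rename h g).
  rewrite /Defs.over free_vars_in_rename; apply: sub_free_vars_in Aag => -[//|u] /=.
  by case: pselect => //= ua [//|].
have Af : Defs.over A f.
  rewrite /Defs.over free_vars_in_rename; apply: sub_free_vars_in hg.
  by move=> -[[]|].
have := q12; rewrite /morley_commute => /(congr1 (@^~ f)) fE.
have : morley K M q1 q2 f.
  rewrite fE /= swf; exists A; split=> //; exists (fun=> a); split.
    by apply: sub_realizes q1a => x; left.
  rewrite /inst rename_comp (_ : _ \o h = id) ?rename_id//; apply: funext => -[[]//|u] /=.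
  by case: pselect => //= ->.
rewrite (morleyE (b := fun=> b) q1inv (@global_type_deciding _ q2) sA MA Af q2b) => q1f.
have : psat (inst (fun=> b) f) (fun=> a).
  apply: q1a; split; first exact: q1f.
  by apply: sub_over (over_inst (fun=> b) Af) => x [|[[] _ <-]]; [left|right].
rewrite psat_inst /psat !sat_rename.
rewrite (_ : _ \o h = copair (fun=> b) id)//; apply: funext => -[//|u] /=.
by case: pselect => //= ->.
Qed.

(** Saturation is stated for variables in ['I_k]; [h] and [h'] translate between [unit] and
    ['I_1]. *)
Lemma realized_over (q : global_type U unit) (A : set U) :
  small K A -> exists b, realizes (restriction q A) (fun=> b).
Proof.
move=> sA; have [_ qfin _] := global_typeP q.
pose h : unit + U -> 'I_1 + U := copair (fun=> inl ord0) inr.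
pose h' : 'I_1 + U -> unit + U := copair (fun=> inl tt) inr.
pose p : set (pformula U 'I_1) := [set f | restriction q A (rename h' f)].
have [|v pv] := U_saturated sA (p := p).
  split=> [f [_]|F Ffin Fp|f Af].
  - rewrite /Defs.over free_vars_in_rename; apply: sub_free_vars_in.
    by move=> -[].
  - have [|_ [f Ff <-]|v Fv] := qfin (rename h' @` F).
    + exact: finite_image.
    + by have [] := Fp f Ff.
    exists (fun=> v tt) => f Ff.
    have := Fv (rename h' f); rewrite /psat sat_rename.
    rewrite (_ : _ \o h' = copair (fun=> v tt) id); last by apply: funext => -[].
    by apply; exists f.
  - have Ah'f : Defs.over A (rename h' f).
      by rewrite /Defs.over free_vars_in_rename; apply: sub_free_vars_in Af => -[].
    by have [qf|qNf] := global_type_deciding q (rename h' f); [left|right].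
exists (v ord0) => f [qf Af].
have pf : p (rename h f).
  by rewrite /p /= rename_comp (_ : h' \o h = id) ?rename_id//; apply: funext => -[[]|].
have := pv _ pf; rewrite /psat sat_rename.
by rewrite (_ : _ \o h = copair (fun=> v ord0) id)//; apply: funext => -[].
Qed.

(* [(b j)_(j in l)] is a Morley sequence over [A] for the types [(q j)_(j in l)],
   built in the order of the list [l]. *)
Fixpoint mseq (q : nat -> global_type U unit) (b : nat -> U) (A : set U)
    (l : seq nat) : Prop :=
  if l is j :: l' then realizes (restriction (q j) A) (fun=> b j) /\ mseq q b (A `|` [set b j]) l'
  else True.

Lemma mseq_rcons q b A l j : mseq q b A (rcons l j) <->
  mseq q b A l /\ realizes (restriction (q j) (A `|` b @` [set` l])) (fun=> b j).
Proof.
elim: l A => [|i l IHl] A /=.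
  rewrite set_nil image_set0 setU0.
  by split=> -[].
by rewrite IHl set_seq_cons image_setU image_set1 setUA; tauto.
Qed.

Lemma eq_mseq q b b' A l : {in l, b =1 b'} -> mseq q b A l -> mseq q b' A l.
Proof.
elim: l A => [//|j l IHl] A bb' /= [qj Al].
rewrite -bb' ?mem_head//; split=> //; apply: IHl => // i li.
by apply: bb'; rewrite inE li orbT.
Qed.

Lemma mseq_exists q k A : small K A -> exists b, mseq q b A (iota 0 k).
Proof.
move=> sA; elim: k => [|k [b bA]].
  by have [u _] := carrier_nonempty U; exists (fun=> u).
have [u qu] := realized_over (q k) (small_setU_image K_uncountable (c := b) (l := iota 0 k) sA).
exists (fun i => if i == k then u else b i).
rewrite -addn1 iotaD cats1 mseq_rcons; split.
  apply: eq_mseq bA => i; rewrite mem_iota => /andP[_ ik].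
  by rewrite ltn_eqF.
rewrite add0n eqxx; apply: sub_realizes qu => x [|[i /=]]; first by left.
by rewrite mem_iota => /andP[_ ik] <-; right; exists i => /=; rewrite ?mem_iota ?ltn_eqF.
Qed.

Section Commuting.
Context (q : nat -> global_type U unit).
Hypothesis q_inv : forall i, invariant_type M (q i).

(** A single Morley sequence tests the whole product: each step tests the newest factor against the
    terms built so far. *)
Lemma iterated_morleyE k (b : nat -> U) (A : set U) (f : pformula U 'I_k.+1) :
  small K A -> M `<=` A -> mseq q b A (iota 0 k.+1) -> Defs.over A f ->
  iterated_morley K M (fun j : 'I_k.+1 => q j) f <->
  psat f (fun j : 'I_k.+1 => b j).
Proof.
elim: k b A f => [|k IHk] b A f sA MA bA Af.
  have [/= q0b _] := bA.
  rewrite /= (realizesE (global_type_deciding _) q0b).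
    rewrite /psat sat_rename (_ : _ \o _ = copair (fun j : 'I_1 => b j) id)//.
    by apply: funext => -[j|//]; rewrite /= ord1.
  by rewrite /Defs.over free_vars_in_rename; apply: sub_free_vars_in Af => -[].
pose S := iterated_morley K M (fun i : 'I_k.+1 => q i).
pose g := rename (copair (inl \o @split_last k.+1) inr) f.
have -> : iterated_morley K M (fun j : 'I_k.+2 => q j) f = morley K M (q k.+1) S g.
  rewrite /= (_ : (fun i : 'I_k.+1 => q (lift ord_max i)) = fun i : 'I_k.+1 => q i)//.
  by apply: funext => i; rewrite lift_max.
(* To decide [h], enlarge [A] by its parameters, build a new Morley sequence over the result and
   apply the induction hypothesis to it. *)
have Sd : deciding S.
  move=> h; have [A' [sA' AA' A'h]] := small_over h sA.
  have MA' : M `<=` A' by move=> x /MA/AA'.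
  have [b' b'A'] := mseq_exists q k.+1 sA'.
  have [hb|nhb] := EM (psat h (fun j : 'I_k.+1 => b' j)); [left|right].
    by apply/(IHk b' A').
  by apply/(IHk b' A').
have [{}bA qb] : mseq q b A (iota 0 k.+1) /\
    realizes (restriction (q k.+1) (A `|` b @` [set` iota 0 k.+1])) (fun=> b k.+1).
  by rewrite -mseq_rcons -cats1 -[[:: k.+1]]/(iota (0 + k.+1) 1) -iotaD addn1.
have Sb : realizes (restriction S A) (fun j : 'I_k.+1 => b j).
  by move=> h [Sh Ah]; apply/(IHk b A).
have Ag : Defs.over A g.
  rewrite /Defs.over free_vars_in_rename; apply: sub_free_vars_in Af.
  by move=> -[j|//] /=; rewrite /split_last; case: (unlift ord_max j).
rewrite (morleyE _ Sd sA MA Ag Sb)//.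
rewrite (realizesE (global_type_deciding _) qb); last first.
  apply: sub_over (over_inst (fun j : 'I_k.+1 => b j) Ag) => x [|[j _ <-]]; first by left.
  by right; exists (val j) => //; rewrite /mkset mem_iota add0n ltn_ord.
rewrite psat_inst /psat sat_rename.
rewrite (_ : _ \o _ = copair (fun j : 'I_k.+2 => b j) id)//.
apply: funext => -[j|//] /=; rewrite /split_last.
by case: (unliftP ord_max j) => [i ->|->//]; congr b; exact: esym (lift_max i).
Qed.

Hypothesis q_comm : forall i j, morley_commute K M (q i) (q j).

Lemma mseq_swap b A i j l : small K A -> M `<=` A ->
  mseq q b A [:: i, j & l] -> mseq q b A [:: j, i & l].
Proof.
move=> sA MA /= [qi [qj Al]]; split; first by apply: sub_realizes qj => x; left.
by split; [exact: (realizes_swap (q_inv j))|rewrite setUAC].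
Qed.

Lemma mseq_front b A l1 j l2 : small K A -> M `<=` A ->
  mseq q b A (l1 ++ j :: l2) -> mseq q b A (j :: l1 ++ l2).
Proof.
elim: l1 A => [//|i l1 IHl] A sA MA.
rewrite cat_cons => -[qi /IHl Al]; apply: mseq_swap => //.
split=> //; apply: Al; first exact: small_setU1.
by move=> x /MA; left.
Qed.

(** Adjacent swaps bring the head of [l] to the front of [l0]; the rest is treated over [A] with
    that element added. Morley sequences may thus be thinned and reordered at will. *)
Lemma mseq_sub b A l0 l : small K A -> M `<=` A -> uniq l ->
  {subset l <= l0} -> mseq q b A l0 -> mseq q b A l.
Proof.
elim: l A l0 => [//|j l IHl] A l0 sA MA /= /andP[jl ul] ll0.
have jl0 : j \in l0 by apply: ll0; rewrite mem_head.
case/splitPr: l0 / jl0 ll0 => l1 l2.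
move=> ll0 /(mseq_front sA MA)[qj Al]; split=> //.
apply: IHl Al => //; first exact: small_setU1.
  by move=> x /MA; left.
move=> i li; have := ll0 i; rewrite inE li orbT => /(_ isT).
by rewrite !mem_cat inE => /or3P[->//|/eqP ij|->]; [rewrite -ij li in jl|rewrite orbT].
Qed.

End Commuting.

Lemma mseq_map q b A (h : nat -> nat) l :
  mseq q b A (map h l) = mseq (q \o h) (b \o h) A l.
Proof. by elim: l A => [//|j l IHl] A /=; rewrite IHl. Qed.

End MorleySequences.

(** * Structures on the natural numbers and swaps *)

(** A bound on one chosen index per value works. It serves to prove images infinite, by exhibiting
    an index in [S] whose value differs from all values below [l]. *)
Lemma finite_image_bounded (W : Type) (a : nat -> W) (S : set nat) :
  finite_set (a @` S) ->
  exists l, forall j, S j -> exists2 i, (i < l)%N & a i = a j.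
Proof.
move=> aSfin.
have /choice[idx idxE] : forall w, exists i, (exists2 j, S j & a j = w) -> a i = w.
  move=> w; have [[j Sj jw]|nSw] := EM (exists2 j, S j & a j = w); first by exists j.
  by exists 0%N.
have /finite_seqP[X XE] : finite_set (idx @` (a @` S)) by exact: finite_image.
exists (\max_(x <- X) x).+1 => j Sj; exists (idx (a j)); last by apply: idxE; exists j.
rewrite ltnS; apply: (@leq_bigmax_seq _ X xpredT id) => //.
suff : [set` X] (idx (a j)) by [].
by rewrite -XE; exists (a j) => //; exists j.
Qed.

(** The elements of one color are countably infinite on both sides or absent from both, so they
    match bijectively. [g] glues these bijections and factors through [a], which may list an element
    repeatedly. *)
Lemma colored_surjection (W Z : Type) (a : nat -> W) (col col' : nat -> Z) :
  (forall i j, a i = a j -> col i = col j) ->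
  (forall i, infinite_set (a @` [set j | col j = col i])) ->
  (forall x, infinite_set [set y | col' y = col' x]) ->
  (forall z, (exists i, col i = z) <-> (exists x, col' x = z)) ->
  exists g : nat -> nat, [/\ forall x, exists j, g j = x,
    forall i j, a i = a j <-> g i = g j & forall j, col' (g j) = col j].
Proof.
move=> acol ainf a'inf colE.
have /choice[k kbij] : forall z, exists k : W -> nat,
    set_bij (a @` [set j | col j = z]) [set y | col' y = z] k.
  move=> z; apply/card_set_bijP; have [[i iz]|ni] := EM (exists i, col i = z).
    have [x xz] := (colE z).1 (ex_intro _ i iz).
    apply: (@card_eq_trans _ _ _ _ [set: nat]).
      apply: eq_card_nat; last by rewrite -iz.
      by apply: sub_countable (card_image_le _ _) _; exact: countableP.
    rewrite card_eq_sym; apply: eq_card_nat; first exact: countableP.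
    by rewrite -xz.
  have -> : [set j | col j = z] = set0.
    by apply/seteqP; split=> // i iz; case: ni; exists i.
  have -> : [set y | col' y = z] = set0.
    by apply/seteqP; split=> // x xz; case: ni; apply/colE; exists x.
  by rewrite image_set0; exact: card_eq00.
have gcol j : col' (k (col j) (a j)) = col j.
  by have [kfun _ _] := kbij (col j); apply: kfun; exists j.
exists (fun j => k (col j) (a j)); split=> [x|i j|//].
- have [_ _ ksurj] := kbij (col' x).
  by have [] := ksurj x erefl => w [j jx <-] kx; exists j; rewrite jx.
- split=> [aij|gij]; first by rewrite aij (acol _ _ aij).
  have colij : col i = col j by rewrite -gcol gij gcol.
  have [_ kinj _] := kbij (col j); apply: kinj; last by rewrite -[in LHS]colij.
    by rewrite inE; exists i.
  by rewrite inE; exists j.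
Qed.

Section Swaps.
Context (L : language).

(* [a'] is the tuple [a] with [i] and [j] exchanged, when [E] is the equality of
   the elements named by the indices. *)
Definition swap_related (E : nat -> nat -> Prop) (i j : nat) k (a a' : 'I_k -> nat) :=
  forall x, [\/ E (a x) i /\ E (a' x) j, E (a x) j /\ E (a' x) i |
    [/\ ~ E (a x) i, ~ E (a x) j & E (a x) (a' x)]].

(** The equality [E] is a parameter so that the condition can be read both on the indices of a type,
    where several indices may name one element, and on a structure with carrier [nat]. *)
Definition swappable (E : nat -> nat -> Prop)
    (P : forall s : rel_symbol L, ('I_(arity s) -> nat) -> Prop) (i j : nat) :=
  forall s (a a' : 'I_(arity s) -> nat), swap_related E i j a a' -> P s a <-> P s a'.

Context (P : forall s : rel_symbol L, ('I_(arity s) -> nat) -> Prop).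
Arguments P : clear implicits.

Definition swapf (x y z : nat) := if z == x then y else if z == y then x else z.

Lemma swap_relatedE x y k (a a' : 'I_k -> nat) :
  swap_related eq x y a a' <-> a' = swapf x y \o a.
Proof.
split=> [aa'|-> i].
  apply: funext => i /=; rewrite /swapf; case: (aa' i) => -[].
  - by move=> -> ->; rewrite eqxx.
  - by move=> -> ->; rewrite eqxx; case: eqP.
  - by move=> /eqP/negPf-> /eqP/negPf-> ->.
rewrite /= /swapf; case: eqP => [->|ax]; first by constructor 1.
by case: eqP => [->|ay]; [constructor 2|constructor 3].
Qed.

Lemma swapfxx x : swapf x x = id.
Proof. by apply: funext => z; rewrite /swapf; case: eqP => [->|]. Qed.

Lemma swapfC x y : swapf x y = swapf y x.
Proof.
apply: funext => z; rewrite /swapf; case: eqP => [->|//]; case: eqP => //.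
Qed.

Lemma swapfK x y : involutive (swapf x y).
Proof.
move=> z; rewrite /swapf; case: (eqVneq z x) => [->|zx].
  by case: (eqVneq y x) => [->//|yx]; rewrite eqxx.
case: (eqVneq z y) => [->|zy]; first by rewrite eqxx.
by rewrite (negPf zx) (negPf zy).
Qed.

(** Conjugation of one transposition by another; this makes swappability transitive. *)
Lemma swapf_conj x y z : x != y -> x != z -> y != z ->
  swapf x y \o swapf y z \o swapf x y = swapf x z.
Proof.
move=> /eqP xy /eqP xz /eqP yz; apply: funext => t; rewrite /= /swapf.
by do ![case: eqP => //]; congruence.
Qed.

Let swp := swappable eq P.

Lemma swappableE x y : swp x y <-> forall s a, P s a <-> P s (swapf x y \o a).
Proof.
split=> [xy s a|xy s a a' /swap_relatedE->//].
by apply: xy; apply/swap_relatedE.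
Qed.

Lemma swappable_refl x : swp x x.
Proof. by apply/swappableE => s a; rewrite swapfxx. Qed.

Lemma swappable_sym x y : swp x y -> swp y x.
Proof. by move/swappableE => xy; apply/swappableE => s a; rewrite swapfC. Qed.

Lemma swappable_trans x y z : swp x y -> swp y z -> swp x z.
Proof.
have [->//|xy] := eqVneq x y; have [->|xz] := eqVneq x z.
  by move=> _ _; exact: swappable_refl.
have [->//|yz] := eqVneq y z.
move=> /swappableE pxy /swappableE pyz; apply/swappableE => s a.
by rewrite -(swapf_conj xy xz yz) -[_ \o a]/(swapf x y \o (swapf y z \o (swapf x y \o a)))
  -pxy -pyz -pxy.
Qed.

Lemma swappable_swapf x y z : swp x y -> swp z (swapf x y z).
Proof.
move=> xy; rewrite /swapf; case: eqP => [->//|_].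
by case: eqP => [->|_]; [exact: swappable_sym|exact: swappable_refl].
Qed.

(* A finite partial bijection respecting swappability is a composition of swaps. *)
Lemma swappable_homogeneous s (u u' : 'I_(arity s) -> nat) :
  (forall i j, u i = u j <-> u' i = u' j) -> (forall i, swp (u i) (u' i)) ->
  P s u <-> P s u'.
Proof.
move=> uu' swpu.
suff [g [gP _ _ gu]] : exists g : nat -> nat,
    [/\ forall a, P s a <-> P s (g \o a), injective g, forall x, swp x (g x) &
    forall i, i \in enum 'I_(arity s) -> g (u i) = u' i].
  by rewrite gP (_ : g \o u = u')//; apply: funext => i; apply: gu; rewrite mem_enum.
elim: (enum _) => [|i l [g [gP ginj gswp gu]]].
  by exists id; split=> // x; exact: swappable_refl.
(* [g] is corrected at [i] by one more swap, of [g (u i)] with [u' i]. Earlier positions keep their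
   values because [u] and [u'] have the same equalities. *)
have si : swp (g (u i)) (u' i).
  exact: swappable_trans (swappable_sym (gswp _)) (swpu i).
exists (swapf (g (u i)) (u' i) \o g); split.
- move=> a; rewrite gP; move/swappableE: si => ->; by [].
- by apply: inj_comp => //; exact: can_inj (swapfK _ _).
- by move=> x; apply: swappable_trans (gswp x) _; exact: swappable_swapf.
move=> j; rewrite inE => /predU1P[->|/gu uj]; first by rewrite /= /swapf eqxx.
rewrite /= uj /swapf; case: eqP => [uji|guij].
  by apply/esym/uu'/ginj; rewrite uj.
case: eqP => [/esym/uu' uij|//]; by case: guij; rewrite uij uj.
Qed.

End Swaps.

(** * Membership in an isomorphism class expressed by atomic formulas *)

Section Coding.
Context (L : language) (U : structure L).

Definition eq_in (p : global_type U nat) (i j : nat) : Prop :=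
  formulas_of p (FEq (inl i) (inl j)).

Definition rel_in (p : global_type U nat) (s : rel_symbol L)
    (a : 'I_(arity s) -> nat) : Prop :=
  formulas_of p (FRel s (inl \o a)).

(** [g] sends an index to the element of [N] that it names. This removes extensions and realizations
    from the description of [B_ U N]. *)
Definition coded (p : global_type U nat) (N : structure L) (g : nat -> N) :=
  [/\ forall y, exists j, g j = y, forall i j, eq_in p i j <-> g i = g j &
    forall s a, @rel_in p s a <-> interp (g \o a)].

Lemma global_type_sat (V : Type) (p : global_type U V) (W : structure L) (v : V + U -> W) :
  (forall f, formulas_of p f -> sat f v) -> forall f, formulas_of p f <-> sat f v.
Proof.
move=> pv f; split; first exact: pv.
by have [//|/pv/= nf /nf] := global_type_deciding p f.
Qed.

Lemma B_coded (N : structure L) (p : global_type U nat) :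
  B_ U N p <-> exists g, @coded p N g.
Proof.
split=> [[W [e [a [_ pa [h [[h' hK h'K] hP]]]]]]|[g [gsurj geq grel]]].
  have {}pa := global_type_sat pa.
  pose x j : substructure (range_nonempty a) := SigSub (mem_set (ex_intro2 _ _ j I erefl)).
  exists (h \o x); split=> [y|i j|s t].
  - have /set_mem[j _ aj] := valP (h' y); exists j.
    by rewrite /= -[RHS]h'K; congr h; apply: val_inj; rewrite /= aj.
  - rewrite /eq_in pa /=; split=> [aij|/(can_inj hK)/(congr1 val)//].
    by congr h; exact: val_inj.
  - by rewrite /rel_in pa /= (hP s (x \o t)).
have [W [e [a [el pa]]]] := global_type_realized p.
exists W, e, a; split=> //; first by move=> f /pa.
have /choice[idx idxE] : forall x : range a, exists j, a j = set_val x.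
  by move=> x; have /set_mem[j _ aj] := valP x; exists j.
have aE i j : a i = a j <-> g i = g j by rewrite -geq /eq_in pa.
have /choice[h' h'E] : forall y, exists x, g (idx x) = y.
  move=> y; have [j gj] := gsurj y.
  pose x : range a := SigSub (mem_set (ex_intro2 _ _ j I erefl)).
  by exists x; rewrite -gj; apply/aE; rewrite idxE.
have ginj : injective (g \o idx).
  by move=> x x' /aE; rewrite !idxE; exact: val_inj.
exists (g \o idx); split; first by exists h' => [x|y]; [apply: ginj; exact: h'E|exact: h'E].
move=> s t; rewrite -[_ \o t]/(g \o (idx \o t)) -grel /rel_in pa /=.
by rewrite (_ : _ \o _ = set_val \o t)//; apply: funext => i /=; rewrite idxE.
Qed.

End Coding.

(** * Borel measurability of the isomorphism class *)

Lemma countable_ord_fun k : countable [set: 'I_k -> nat].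
Proof.
rewrite (_ : [set: _] = (fun (f : {ffun 'I_k -> nat}) i => f i) @` setT).
  by apply: sub_countable (card_image_le _ _) _; exact: countableP.
apply/seteqP; split=> // f _; exists [ffun i => f i] => //.
by apply: funext => i; rewrite ffunE.
Qed.

Section MeasurablePredicates.
Context d (T : measurableType d).

(** Stated for predicates, so that the closure lemmas follow the logical form of a condition. *)
Definition measurable_pred (Q : T -> Prop) := measurable [set p | Q p].

Lemma measurable_pred_not Q : measurable_pred Q -> measurable_pred (fun p => ~ Q p).
Proof. by move=> mQ; apply: measurableC. Qed.

Lemma measurable_pred_and Q Q' : measurable_pred Q -> measurable_pred Q' ->
  measurable_pred (fun p => Q p /\ Q' p).
Proof. by move=> mQ mQ'; apply: measurableI. Qed.

Lemma measurable_pred_or Q Q' : measurable_pred Q -> measurable_pred Q' ->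
  measurable_pred (fun p => Q p \/ Q' p).
Proof. by move=> mQ mQ'; apply: measurableU. Qed.

Lemma measurable_pred_imp Q Q' : measurable_pred Q -> measurable_pred Q' ->
  measurable_pred (fun p => Q p -> Q' p).
Proof.
move=> mQ mQ'; rewrite (_ : (fun p => _) = fun p => ~ Q p \/ Q' p).
  by apply: measurable_pred_or => //; exact: measurable_pred_not.
by apply: funext => p; rewrite implyE.
Qed.

Lemma measurable_pred_iff Q Q' : measurable_pred Q -> measurable_pred Q' ->
  measurable_pred (fun p => Q p <-> Q' p).
Proof. by move=> mQ mQ'; apply: measurable_pred_and; exact: measurable_pred_imp. Qed.

Lemma measurable_pred_cst (A : Prop) : measurable_pred (fun=> A).
Proof.
have [a|na] := EM A.
  by rewrite (_ : A = True) ?propeqE//; exact: measurableT.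
by rewrite (_ : A = False) ?propeqE//; exact: measurable0.
Qed.

Lemma measurable_pred_exists (I : Type) (Q : I -> T -> Prop) : countable [set: I] ->
  (forall i, measurable_pred (Q i)) -> measurable_pred (fun p => exists i, Q i p).
Proof.
move=> cI mQ; have := countable_bigcupT_measurable cI mQ; congr measurable.
by apply/seteqP; split=> p /= [i]; [move=> _ Qi; exists i|move=> Qi; exists i].
Qed.

Lemma measurable_pred_forall (I : Type) (Q : I -> T -> Prop) : countable [set: I] ->
  (forall i, measurable_pred (Q i)) -> measurable_pred (fun p => forall i, Q i p).
Proof.
move=> cI mQ; rewrite (_ : (fun p => _) = fun p => ~ exists i, ~ Q i p).
  apply/measurable_pred_not/measurable_pred_exists => // i.
  exact: measurable_pred_not.
by apply: funext => p; apply: propext; split=> [Qp [i]|/forallNP Qp i]; [|apply: contrapT].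
Qed.

End MeasurablePredicates.

Section BorelIsomorphismClass.
Context (L : language) (U : structure L).
Hypothesis L_countable : countable [set: rel_symbol L].

Let gtype := borel (global_type U nat).

Lemma measurable_formula (V : Type) (f : pformula U V) :
  measurable_pred (fun p : borel (global_type U V) => formulas_of p f).
Proof.
apply: sub_sigma_algebra => /=.
exists [set clopen_of f] => /=; last by rewrite bigcup_set1.
move=> _ ->; exists [fset f]%fset => [g _|]; first exact: mem_set.
by rewrite set_fset1 bigcap_set1.
Qed.

Lemma measurable_eq_in i j : measurable_pred (fun p : gtype => eq_in p i j).
Proof. exact: measurable_formula. Qed.

Lemma measurable_rel_in s a : measurable_pred (fun p : gtype => @rel_in L U p s a).
Proof. exact: measurable_formula. Qed.

Lemma measurable_swappable i j :
  measurable_pred (fun p : gtype => swappable (eq_in p) (@rel_in L U p) i j).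
Proof.
apply: measurable_pred_forall => // s.
apply: measurable_pred_forall => [|a]; first exact: countable_ord_fun.
apply: measurable_pred_forall => [|a']; first exact: countable_ord_fun.
apply: measurable_pred_imp; last first.
  by apply: measurable_pred_iff; exact: measurable_rel_in.
apply: measurable_pred_forall => // x.
rewrite (_ : (fun p => _) = fun p : gtype => (eq_in p (a x) i /\ eq_in p (a' x) j) \/
  (eq_in p (a x) j /\ eq_in p (a' x) i) \/
  (~ eq_in p (a x) i /\ ~ eq_in p (a x) j /\ eq_in p (a x) (a' x))); last first.
  apply: funext => p; apply: propext.
  split=> [[?|?|[? ? ?]]|[?|[?|[? [? ?]]]]]; by [left|right; left|right; right|
    constructor 1|constructor 2|constructor 3].
by do ![apply: measurable_pred_or|apply: measurable_pred_and|
  apply: measurable_pred_not|exact: measurable_eq_in].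
Qed.

Context (n : nat) (P : forall s : rel_symbol L, ('I_(arity s) -> nat) -> Prop).
Arguments P : clear implicits.

Let N : structure L := @Structure L nat P (ex_intro _ 0%N I).
Let swp := swappable eq P.

Context (y : 'I_n -> nat).
Hypothesis P_infinite : forall x, infinite_set [set x' | swp x x'].
Hypothesis P_cover : forall x, exists c, swp x (y c).

Let sw (p : global_type U nat) := swappable (eq_in p) (@rel_in L U p).

Lemma coded_swappable p (g : nat -> N) i j : coded p g ->
  sw p i j <-> swp (g i) (g j).
Proof.
move=> [gsurj geq grel].
have relE k (a a' : 'I_k -> nat) : swap_related (eq_in p) i j a a' <->
    swap_related eq (g i) (g j) (g \o a) (g \o a').
  have geqE x x' : eq_in p x x' = (g x = g x') by apply/propext/geq.
  by split=> aa' x; have := aa' x; rewrite !geqE.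
split=> pij s a a'; last by rewrite relE !grel => /pij.
(* Tuples of [N] are lifted to tuples of indices along the surjection [g]. *)
have /choice[b bE] := gsurj.
rewrite (_ : a = g \o (b \o a)); last by apply: funext => x /=; rewrite bE.
rewrite (_ : a' = g \o (b \o a')); last by apply: funext => x /=; rewrite bE.
by rewrite -relE => /pij; rewrite !grel.
Qed.

(* [t] picks a representative of each class of the swappability relation. Since
   the classes are finitely many and infinite, a countable structure with
   equality [eq_in p] is isomorphic to [N] as soon as its classes match those of
   [N] and its relations depend on classes and equalities only as in [N]. *)
Definition coding_condition (t : 'I_n -> nat) (p : global_type U nat) :=
  (forall i, exists c, forall c', sw p i (t c') <-> swp (y c) (y c')) /\
  (forall c c', sw p (t c) (t c') <-> swp (y c) (y c')) /\
  (forall i l, exists j, (forall c, sw p j (t c) <-> sw p i (t c)) /\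
     forall i', (i' < l)%N -> ~ eq_in p i' j) /\
  (forall s (a u : 'I_(arity s) -> nat),
     (forall x c, sw p (a x) (t c) <-> swp (u x) (y c)) ->
     (forall x x', eq_in p (a x) (a x') <-> u x = u x') ->
     rel_in p a <-> P s u).

Lemma measurable_coding_condition t :
  measurable_pred (coding_condition t : gtype -> Prop).
Proof.
have msw := measurable_swappable; have meq := measurable_eq_in.
have mrel := measurable_rel_in; have cst := @measurable_pred_cst _ gtype.
have cfun := countable_ord_fun.
have cnat : countable [set: nat] by exact: countableP.
have cord k : countable [set: 'I_k] by exact: countableP.
do ![apply: measurable_pred_and].
- apply: measurable_pred_forall => // i; apply: measurable_pred_exists => // c.
  apply: measurable_pred_forall => // c'.
  by apply: measurable_pred_iff; [exact: msw|exact: cst].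
- do 2![apply: measurable_pred_forall => // ?].
  by apply: measurable_pred_iff; [exact: msw|exact: cst].
- do 2![apply: measurable_pred_forall => // ?]; apply: measurable_pred_exists => // j.
  apply: measurable_pred_and; apply: measurable_pred_forall => // c.
    by apply: measurable_pred_iff; exact: msw.
  by apply: measurable_pred_imp; [exact: cst|apply: measurable_pred_not; exact: meq].
do 3![apply: measurable_pred_forall => // ?].
do ![apply: measurable_pred_imp].
- do 2![apply: measurable_pred_forall => // ?].
  by apply: measurable_pred_iff; [exact: msw|exact: cst].
- do 2![apply: measurable_pred_forall => // ?].
  by apply: measurable_pred_iff; [exact: meq|exact: cst].
by apply: measurable_pred_iff; [exact: mrel|exact: cst].
Qed.

Lemma swap_class x y' : swp x y' -> swp x = swp y'.
Proof.
move=> xy; apply: funext => z; apply: propext; split; apply: swappable_trans => //.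
exact: swappable_sym.
Qed.

(** From [g] to [t], take preimages of the representatives [y]. Conversely, color an index by the
    [t c] it is swappable with, and an element of [N] by the [y c]: the first three clauses allow
    the colors to be matched, and the last makes the matching preserve the relations. *)
Lemma coding_conditionP p :
  (exists g : nat -> N, coded p g) <-> exists t, coding_condition t p.
Proof.
split=> [[g pg]|[t [t1 [t2 [t3 t4]]]]].
  have [gsurj geq grel] := pg.
  have /choice[t tE] : forall c, exists j, g j = y c by move=> c; exact: gsurj.
  have swE i j : sw p i j <-> swp (g i) (g j) by exact: coded_swappable.
  exists t; split; [|split; [|split]].
  - move=> i; have [c gic] := P_cover (g i); exists c => c'.
    by rewrite swE tE (swap_class gic).
  - by move=> c c'; rewrite swE !tE.
  (* An infinite class is not exhausted by the elements named by indices below [l]. *)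
  - move=> i l; have := infinite_setD (@P_infinite (g i)) (finite_image g (finite_II l)).
    move=> /infinite_setN0[x [gix nx]]; have [j jx] := gsurj x; exists j; split=> [c|i' i'l].
      by rewrite !swE jx (swap_class gix).
    by rewrite geq jx => gi'x; apply: nx; exists i'.
  move=> s a u au aeq; rewrite grel; apply: swappable_homogeneous.
    by move=> x x'; rewrite -aeq geq.
  move=> x; have [c uc] := P_cover (u x).
  have /au : swp (u x) (y c) by [].
  by move=> /swE; rewrite tE => gc; apply: swappable_trans gc (swappable_sym uc).
have [W [e [a [_ pa]]]] := global_type_realized p.
have eqE i j : eq_in p i j <-> a i = a j by rewrite /eq_in pa.
pose col j := fun c => sw p j (t c).
pose col' x := fun c => swp x (y c).
have [||||g [gsurj geq gcol]] := @colored_surjection W ('I_n -> Prop) a col col'.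
- move=> i j aij; apply: funext => c; apply: propext.
  have E k : eq_in p k i = eq_in p k j by apply: propext; rewrite !eqE aij.
  have relE k (b b' : 'I_k -> nat) : swap_related (eq_in p) i (t c) b b' <->
    swap_related (eq_in p) j (t c) b b'.
    by split=> bb' x; have := bb' x; rewrite !E.
  by split=> pij s b b' bb'; apply: pij; apply/relE.
- move=> i afin; have [l lP] := finite_image_bounded afin.
  have [j [ji nj]] := t3 i l.
  have /lP[i' i'l ai'j] : col j = col i by apply: funext => c; apply: propext; exact: ji.
  by apply: (nj i' i'l); apply/eqE.
- move=> x; apply: sub_infinite_set (@P_infinite x) => x' xx' /=.
  by rewrite /col' (swap_class xx').
- move=> z; split=> [[i <-]|[x <-]].
    have [c ic] := t1 i; exists (y c).
    by apply: funext => c'; apply: propext; rewrite /col ic.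
  have [c xc] := P_cover x; exists (t c).
  by apply: funext => c'; apply: propext; rewrite /col t2 /col' (swap_class xc).
exists g; split=> // [i j|s b]; first by rewrite eqE geq.
apply: t4 => [x c|x x']; last by rewrite eqE geq.
by have := congr1 (@^~ c) (gcol (b x)); rewrite /col /col' => <-.
Qed.

Lemma measurable_B : measurable (B_ U N : set gtype).
Proof.
rewrite (_ : B_ U N = [set p | exists t, coding_condition t p]).
  exact: (measurable_pred_exists (countable_ord_fun n) measurable_coding_condition).
by apply/seteqP; split=> p; rewrite B_coded coding_conditionP.
Qed.

End BorelIsomorphismClass.

(** * Almost every type is generic *)

Section Implications.
Context (L : language).

(** With [g = FBot], its negation is the conjunction of the [F i]; with negated premises as well, it
    is a disjunction. *)
Definition FImps (V : Type) (I : eqType) (l : seq I) (F : I -> formula L V)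
    (g : formula L V) : formula L V :=
  foldr (fun i f => FImp (F i) f) g l.

Lemma sat_FImps (S : structure L) (V : Type) (I : eqType) (l : seq I)
    (F : I -> formula L V) (g : formula L V) (v : V -> S) :
  sat (FImps l F g) v <-> ((forall i, i \in l -> sat (F i) v) -> sat g v).
Proof.
elim: l => [|i l IHl] /=; first by split=> [//|]; apply.
rewrite IHl; split=> [Fil Fl|Fl Fi Fil].
  by apply: Fil => [|j jl]; apply: Fl; rewrite inE ?eqxx ?jl ?orbT.
by apply: Fl => j; rewrite inE => /predU1P[->|/Fil].
Qed.

Lemma rename_FImps (V W : Type) (h : V -> W) (I : eqType) (l : seq I)
    (F : I -> formula L V) (g : formula L V) :
  rename h (FImps l F g) = FImps l (fun i => rename h (F i)) (rename h g).
Proof. by elim: l => //= i l ->. Qed.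

Lemma free_vars_in_FImps (V : Type) (D : V -> Prop) (I : eqType) (l : seq I)
    (F : I -> formula L V) (g : formula L V) :
  (forall i, free_vars_in D (F i)) -> free_vars_in D g ->
  free_vars_in D (FImps l F g).
Proof. by move=> DF Dg; elim: l => //= i l IHl; split. Qed.

Context (U : structure L).

Section GlobalTypes.
Context (V : Type) (p : global_type U V).

Lemma global_type_FNot f : formulas_of p (FNot f) <-> ~ formulas_of p f.
Proof. by have [W [e [a [_ pa]]]] := global_type_realized p; rewrite !pa. Qed.

Lemma global_type_FBot : ~ formulas_of p FBot.
Proof. by have [W [e [a [_ pa]]]] := global_type_realized p; rewrite pa. Qed.

Lemma global_type_FImps (I : eqType) (l : seq I) F g :
  formulas_of p (FImps l F g) <->
  ((forall i, i \in l -> formulas_of p (F i)) -> formulas_of p g).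
Proof.
have [W [e [a [_ pa]]]] := global_type_realized p; rewrite !pa sat_FImps.
by split=> Fg Fl; apply: Fg => i /Fl/pa.
Qed.

End GlobalTypes.

Lemma global_type_eq (V : Type) (p p' : global_type U V) :
  formulas_of p = formulas_of p' -> p = p'.
Proof.
case: p p' => p pP [p' p'P] /= pp'; rewrite pp' in pP *.
by congr GlobalType; exact: Prop_irrelevance.
Qed.

Definition at_var (V : Type) (x : V) (f : pformula U unit) : pformula U V :=
  rename (copair (fun=> inl x) inr) f.

Lemma psat_at_var (V : Type) (x : V) (f : pformula U unit) (v : V -> U) :
  psat (at_var x f) v <-> psat f (fun=> v x).
Proof.
rewrite /psat sat_rename (_ : _ \o _ = copair (fun=> v x) id)//.
by apply: funext => -[].
Qed.

Lemma over_at_var (A : set U) (V : Type) (x : V) (f : pformula U unit) :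
  Defs.over A f -> Defs.over A (at_var x f).
Proof. by rewrite /Defs.over free_vars_in_rename; apply: sub_free_vars_in => -[]. Qed.

Lemma in_seq_at_var k (j : 'I_k.+1) (f : pformula U unit) :
  in_seq (at_var j f) = at_var (nat_of_ord j) f.
Proof.
rewrite /in_seq /at_var rename_comp; congr (rename _ f).
by apply: funext => -[].
Qed.

Lemma in_seq_FNot k (f : pformula U 'I_k.+1) : in_seq (FNot f) = FNot (in_seq f).
Proof. by []. Qed.

Lemma in_seq_FImps (p : global_type U nat) k (I : eqType) (l : seq I)
    (F : I -> pformula U 'I_k.+1) g :
  formulas_of p (in_seq (FImps l F g)) <->
  ((forall i, i \in l -> formulas_of p (in_seq (F i))) -> formulas_of p (in_seq g)).
Proof. by rewrite /in_seq rename_FImps global_type_FImps. Qed.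

(** [chi i] is a conjunction of formulas of [q i], one excluding each [q j] different from [q i].
    The conclusion is an equality of types because the list [q] may repeat. *)
Lemma separating_formulas n (q : 'I_n -> global_type U unit) :
  exists chi : 'I_n -> pformula U unit,
    (forall i, formulas_of (q i) (chi i)) /\
    forall i j, formulas_of (q j) (chi i) -> q j = q i.
Proof.
suff /choice[chi chiP] : forall i, exists f, formulas_of (q i) f /\
    forall j, formulas_of (q j) f -> q j = q i.
  by exists chi; split=> i; have [] := chiP i.
move=> i.
have /choice[f fP] : forall j, exists f, formulas_of (q i) f /\
    (formulas_of (q j) f -> q j = q i).
  move=> j; have [ij|ij] := EM (q j = q i).
    by exists (FNot FBot); split=> //; apply/global_type_FNot; exact: global_type_FBot.
  have /existsNP[f nf] : ~ forall f, formulas_of (q j) f <-> formulas_of (q i) f.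
    move=> fE; apply/ij/global_type_eq/funext => f.
    exact/propext/fE.
  have [qif|nqif] := EM (formulas_of (q i) f).
    by exists f; split=> // qjf; case: nf.
  exists (FNot f); split; first exact/global_type_FNot.
  by move=> /global_type_FNot nqjf; case: nf.
exists (FNot (FImps (enum 'I_n) f FBot)); split.
  apply/global_type_FNot; rewrite global_type_FImps => fF.
  by apply: (@global_type_FBot _ (q i)); apply: fF => j _; have [] := fP j.
move=> j /global_type_FNot nf; apply: (fP j).2; apply: contrapT => nfj.
by apply/nf/global_type_FImps => fl; case: nfj; apply: fl; rewrite mem_enum.
Qed.

End Implications.

Import Order.TTheory GRing.Theory Num.Theory.
Local Open Scope ring_scope.

Lemma prod_tail (R : comNzRingType) (c : R) l m :
  \prod_(j < (l + m)%N) (if (l <= j)%N then c else 1) = c ^+ m.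
Proof.
elim: m => [|m IHm].
  by rewrite addn0 big1// => j _; rewrite leqNgt ltn_ord.
by rewrite addnS big_ord_recr/= IHm leq_addr exprSr.
Qed.

Lemma ae_forall_countable d (T : measurableType d) (R : realType)
    (mu : {measure set T -> \bar R}) (I : Type) (Q : I -> T -> Prop) :
  countable [set: I] -> (forall i, \forall x \ae mu, Q i x) ->
  \forall x \ae mu, forall i, Q i x.
Proof.
move=> /Pcountable[I' IE]; rewrite {}IE in Q * => Qae.
(* Indices are coded by naturals; a code of no index carries the condition [True]. *)
suff : \forall x \ae mu, forall m, if @choice.unpickle I' m is Some i then Q i x else True.
  by apply: filterS => x Qx i; have := Qx (choice.pickle i); rewrite choice.pickleK.
by apply: ae_foralln => m; case: choice.unpickle => [i|]; [exact: Qae|exact: aeW].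
Qed.

(** * Types that follow a word of colors *)

Section MorleyMeasure.
Context (R : realType) (L : language) (K : Type) (U : structure L) (M : set U).
Hypothesis L_countable : countable [set: rel_symbol L].
Hypothesis K_uncountable : ~ countable [set: K].
Hypothesis U_saturated : saturated K U.
Hypothesis M_small : small K M.
Hypothesis M_nonempty : M !=set0.
Context (n : nat) (q : 'I_n -> global_type U unit) (r : 'I_n -> R).
Hypothesis q_inv : forall i, invariant_type M (q i).
Hypothesis r_ge0 : forall i, 0 <= r i.
Hypothesis r_sum : \sum_(i < n) r i = 1.
Hypothesis q_comm : forall i j, morley_commute K M (q i) (q j).
Hypothesis q_nonrealized : forall i, 0 < r i -> forall u,
  ~ formulas_of (q i) (FEq (inl tt) (inr u)).

Let gtype := borel (global_type U nat).
Let word k (w : 'I_k.+1 -> 'I_n) := iterated_morley K M (fun j => q (w j)).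

(** Take a Morley sequence [b]. By commutation its one-term and two-term subsequences are Morley
    over [A] too, so each entry realizes its own color, and of two entries the second avoids the
    first because its color is not realized. *)
Lemma word_realized k (w : 'I_k.+1 -> 'I_n) (A : set U) : small K A -> M `<=` A ->
  exists b : 'I_k.+1 -> U,
  [/\ forall f, Defs.over A f -> word w f <-> psat f b,
      forall j f, Defs.over A f -> psat f (fun=> b j) <-> formulas_of (q (w j)) f &
      (forall j, 0 < r (w j)) -> injective b].
Proof.
move=> sA MA; pose th j := q (w (inord j)).
have [b bA] := mseq_exists K_uncountable U_saturated th k.+1 sA.
have th_inv j : invariant_type M (th j) by exact: q_inv.
have th_comm i j : morley_commute K M (th i) (th j) by exact: q_comm.
have sub l : uniq l -> {subset l <= iota 0 k.+1} -> mseq th b A l.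
  move=> ul ll.
  exact: (mseq_sub K_uncountable M_nonempty th_inv th_comm sA MA ul ll bA).
exists (fun j => b j); split.
- move=> f Af.
  rewrite -(iterated_morleyE K_uncountable U_saturated M_nonempty th_inv sA MA bA Af).
  rewrite /word (_ : (fun j : 'I_k.+1 => th j) = fun j => q (w j))//.
  by apply: funext => j; rewrite /th inord_val.
- move=> j f Af.
  have [|] := sub [:: val j] isT; first by move=> i; rewrite inE mem_iota => /eqP->/=.
  move=> bj _; rewrite -(realizesE (@global_type_deciding _ _ _ _) bj Af).
  by rewrite /th inord_val.
move=> rpos i j; apply: contraPP => /eqP ij bij.
have [||_ [bj _]] := sub [:: val i; val j].
- by rewrite /= inE val_eqE ij.
- by move=> x; rewrite mem_iota add0n !inE => /orP[] /eqP->; rewrite /= ltn_ord.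
have : psat (FNot (FEq (inl tt) (inr (b i)))) (fun=> b j).
  apply: bj; split; last by split=> //=; split=> //; right.
  by apply/global_type_FNot; apply: q_nonrealized; rewrite /th.
by apply; rewrite /= bij.
Qed.

Lemma small_over_family (chi : 'I_n -> pformula U unit) :
  exists A, [/\ small K A, M `<=` A & forall i, Defs.over A (chi i)].
Proof.
suff [A [sA MA Achi]] : exists A, [/\ small K A, M `<=` A &
    forall i, i \in enum 'I_n -> Defs.over A (chi i)].
  by exists A; split=> // i; apply: Achi; rewrite mem_enum.
elim: (enum _) => [|i l [A [sA MA Al]]]; first by exists M; split.
have [A' [sA' AA' A'i]] := small_over K_uncountable (chi i) sA.
exists A'; split=> // [x /MA/AA'//|j]; rewrite inE => /predU1P[->//|/Al].
exact: sub_over.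
Qed.

(** Colors are compared through [q], which may repeat a type. By the third clause distinct indices
    name distinct elements, so the relations in the last clause determine the induced structure. *)
Definition generic_word (p : global_type U nat) (w : nat -> 'I_n) :=
  [/\ forall j, 0 < r (w j),
      forall i, 0 < r i -> forall l, exists2 j, (l <= j)%N & q (w j) = q i,
      forall i j, eq_in p i j -> i = j &
      forall k s (a : 'I_(arity s) -> 'I_k.+1),
        rel_in p (fun x => nat_of_ord (a x)) <->
        word (fun j : 'I_k.+1 => w j) (FRel s (inl \o a))].

(** A Morley sequence [b'] for [w'], read along the injection [h], is by commutation a Morley
    sequence for [w]; so the same elements of [U] test both relations. *)
Lemma generic_word_rel p p' w w' (h : nat -> nat) s (a : 'I_(arity s) -> nat) :
  generic_word p w -> generic_word p' w' -> injective h ->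
  (forall j, q (w' (h j)) = q (w j)) -> rel_in p a <-> rel_in p' (h \o a).
Proof.
move=> [_ _ _ pw] [_ _ _ p'w'] hinj hq.
pose k := \max_x a x; pose k' := \max_(j < k.+1) h j.
have ak x : (a x < k.+1)%N by rewrite ltnS; exact: (leq_bigmax x).
have hk j : (j < k.+1)%N -> (h j < k'.+1)%N.
  by move=> jk; rewrite ltnS; exact: (@leq_bigmax _ (fun j : 'I_k.+1 => h j) (Ordinal jk)).
pose th j := q (w j); pose th' j := q (w' j).
have th_inv j : invariant_type M (th j) by exact: q_inv.
have th'_inv j : invariant_type M (th' j) by exact: q_inv.
have th'_comm i j : morley_commute K M (th' i) (th' j) by exact: q_comm.
have [b' b'M] := mseq_exists K_uncountable U_saturated th' k'.+1 M_small.
have MM : M `<=` M by [].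
have bM : mseq th (b' \o h) M (iota 0 k.+1).
  rewrite (_ : th = th' \o h); last by apply: funext => j; rewrite /th -hq.
  rewrite -mseq_map.
  apply: (mseq_sub K_uncountable M_nonempty th'_inv th'_comm M_small MM _ _ b'M).
    by rewrite map_inj_uniq// iota_uniq.
  by move=> _ /mapP[j + ->]; rewrite !mem_iota /= !add0n; exact: hk.
have overM m (t : 'I_(arity s) -> 'I_m.+1) :
    Defs.over M (FRel s (inl \o t) : pformula U 'I_m.+1) by [].
pose t x : 'I_k.+1 := Ordinal (ak x); pose t' x : 'I_k'.+1 := Ordinal (hk _ (ak x)).
apply: (iff_trans (pw k s t)).
apply: (iff_trans (iterated_morleyE K_uncountable U_saturated M_nonempty th_inv
  M_small MM bM (overM _ t))).
apply: iff_sym; apply: (iff_trans (p'w' k' s t')).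
exact: (iterated_morleyE K_uncountable U_saturated M_nonempty th'_inv
  M_small MM b'M (overM _ t')).
Qed.

(** The case [p' = p] of the previous transfer, with [h] the transposition of [i] and [j]. *)
Lemma generic_word_swappable p w i j : generic_word p w -> q (w i) = q (w j) ->
  swappable eq (@rel_in L U p) i j.
Proof.
move=> pw ij; apply/swappableE => s a; apply: (generic_word_rel _ pw pw).
  exact: can_inj (swapfK _ _).
move=> x; rewrite /swapf; case: eqP => [->//|_].
by case: eqP => [->|].
Qed.

Lemma generic_word_infinite p w i : generic_word p w ->
  infinite_set [set j | q (w j) = q (w i)].
Proof.
move=> [wpos winf _ _] /(finite_image id)/finite_image_bounded[l lP].
have [j lj ji] := winf (w i) (wpos i) l.
by have [j' j'l /= j'j] := lP j ji; rewrite -j'j leqNgt j'l in lj.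
Qed.

(** Each color of positive weight occupies infinitely many indices in both words, which gives a
    color-preserving bijection of the indices; commutation makes it preserve the relations. *)
Lemma generic_word_coded p p' w w' (N := @Structure L nat (@rel_in L U p') (ex_intro _ 0%N I)) :
  generic_word p w -> generic_word p' w' -> B_ U N p.
Proof.
move=> pw p'w'; have [wpos winf weq _] := pw; have [w'pos w'inf _ _] := p'w'.
have [//||||g [gsurj geq gcol]] := @colored_surjection nat _ id (q \o w) (q \o w').
- by move=> i j ->.
- by move=> i; rewrite image_id; exact: (generic_word_infinite pw).
- by move=> i; exact: (generic_word_infinite p'w').
- move=> z; split=> -[i <-].
    by have [j _ ji] := w'inf _ (wpos i) 0%N; exists j.
  by have [j _ ji] := winf _ (w'pos i) 0%N; exists j.
apply/B_coded; exists g; split=> // [i j|s a].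
  rewrite -geq; split; first exact: weq.
  move=> ->; have [W [e [a [_ pa]]]] := global_type_realized p.
  by rewrite /eq_in pa.
by apply: (generic_word_rel _ pw p'w'); [move=> i j; rewrite -geq|exact: gcol].
Qed.

Lemma generic_word_measurable_B p w (N := @Structure L nat (@rel_in L U p) (ex_intro _ 0%N I)) :
  generic_word p w -> measurable (B_ U N : set gtype).
Proof.
move=> pw; have [wpos winf _ _] := pw.
(* [y i] is a place of color [i]. Colors of weight 0 get the default 0, which is harmless since
   representatives may repeat. *)
have /choice[y yP] : forall i, exists j, 0 < r i -> q (w j) = q i.
  move=> i; have [ri|nri] := EM (0 < r i); last by exists 0%N.
  by have [j _ ji] := winf i ri 0%N; exists j.
apply: (measurable_B L_countable (y := y)) => x.
  apply: sub_infinite_set (@generic_word_infinite p w x pw) => j /= jx.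
  exact: (generic_word_swappable pw).
by exists (w x); apply: (generic_word_swappable pw); rewrite yP.
Qed.

(** * Almost sure properties of a random type *)

Context (P : probability gtype R).
Hypothesis P_mu : morley_measure K M r q P.

Local Instance ae_P_filter : Filter (almost_everywhere P).
Proof. exact: ae_filter_ringOfSetsType. Qed.

(** The weights of all words sum to a power of the sum of the [r i], that is to 1; words with a
    color of weight 0 contribute nothing, and [f] holds for all others. *)
Lemma ae_in_seq k (f : pformula U 'I_k.+1) :
  (forall w : 'I_k.+1 -> 'I_n, (forall j, 0 < r (w j)) -> word w f) ->
  \forall p \ae P, formulas_of (p : global_type U nat) (in_seq f).
Proof.
move=> fw; have mf := @measurable_formula L U nat (in_seq f).
have Pf : P (clopen_of (in_seq f)) = 1%E.
  rewrite P_mu.2; congr (_%:E).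
  transitivity (\prod_(j < k.+1) \sum_(i < n) r i); last by rewrite big1.
  rewrite bigA_distr_bigA; apply: eq_bigr => w _.
  have [wpos|/existsNP[j /negP]] := EM (forall j, 0 < r (w j)).
    by rewrite asboolT ?mulr1//; exact: fw.
  rewrite lt_neqAle r_ge0 andbT negbK => /eqP rj.
  by rewrite (bigD1 j)//= -rj !mul0r.
exists (~` clopen_of (in_seq f)); split=> //; first exact: measurableC.
by rewrite probability_setC// Pf subee.
Qed.

Context (chi : 'I_n -> pformula U unit).
Hypothesis chi_q : forall i, formulas_of (q i) (chi i).
Hypothesis chi_sep : forall i j, formulas_of (q j) (chi i) -> q j = q i.

Lemma word_realized_chi k (w : 'I_k.+1 -> 'I_n) :
  exists (A : set U) (b : 'I_k.+1 -> U),
  [/\ forall i, Defs.over A (chi i),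
      forall f, Defs.over A f -> word w f <-> psat f b,
      forall j i, psat (chi i) (fun=> b j) <-> formulas_of (q (w j)) (chi i) &
      (forall j, 0 < r (w j)) -> injective b].
Proof.
have [A [sA MA Achi]] := small_over_family chi.
have [b [bw bj binj]] := word_realized w sA MA.
by exists A, b; split=> // j i; exact: bj.
Qed.

Lemma ae_chi_cover j : \forall p \ae P,
  exists i, 0 < r i /\ formulas_of (p : global_type U nat) (at_var j (chi i)).
Proof.
(* [f] denies that every [chi i] of positive weight fails at the last of [j + 1] variables, the one
   of index [j]. *)
pose f : pformula U 'I_j.+1 := FImps [seq i <- enum 'I_n | 0 < r i]
  (fun i => FNot (at_var ord_max (chi i))) FBot.
have : \forall p \ae P, formulas_of (p : global_type U nat) (in_seq f).
  apply: ae_in_seq => w wpos; have [A [b [Achi bw bchi _]]] := word_realized_chi w.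
  apply/bw; first by apply: free_vars_in_FImps => // i; split=> //; exact: over_at_var.
  apply/sat_FImps => /(_ (w ord_max)); rewrite mem_filter wpos mem_enum => /(_ isT).
  by apply; apply/psat_at_var/bchi/chi_q.
apply: filterS => p /in_seq_FImps pf.
apply: contrapT => np; apply: (@global_type_FBot _ _ _ p); apply: pf => i.
rewrite mem_filter => /andP[ri _].
rewrite in_seq_FNot in_seq_at_var; apply/global_type_FNot => pi.
by apply: np; exists i.
Qed.

Lemma ae_chi_unique j i i' : q i <> q i' -> \forall p \ae P,
  ~ (formulas_of (p : global_type U nat) (at_var j (chi i)) /\
     formulas_of p (at_var j (chi i'))).
Proof.
move=> ii'.
pose f : pformula U 'I_j.+1 := FImps [:: i; i'] (fun i => at_var ord_max (chi i)) FBot.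
have : \forall p \ae P, formulas_of (p : global_type U nat) (in_seq f).
  apply: ae_in_seq => w wpos; have [A [b [Achi bw bchi _]]] := word_realized_chi w.
  apply/bw; first by apply: free_vars_in_FImps => // l; exact: over_at_var.
  apply/sat_FImps => fb; apply: ii'.
  have chiw l : l \in [:: i; i'] -> q (w ord_max) = q l.
    by move=> /fb/psat_at_var/bchi/chi_sep.
  by rewrite -chiw ?mem_head// -chiw// !inE eqxx orbT.
apply: filterS => p /in_seq_FImps pf [pi pi'].
apply: (@global_type_FBot _ _ _ p); apply: pf => l.
rewrite in_seq_at_var !inE.
by move=> /orP[] /eqP->.
Qed.

Lemma measurable_chi_tail i l : measurable_pred
  (fun p : gtype => forall j, (l <= j)%N -> ~ formulas_of p (at_var j (chi i))).
Proof.
apply: measurable_pred_forall => [|j]; first exact: countableP.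
apply: measurable_pred_imp; first exact: measurable_pred_cst.
by apply: measurable_pred_not; exact: measurable_formula.
Qed.

(** A contributing word avoids color [i] at the [m + 1] places [l, ..., l + m]; the places are
    independent, and each avoids [i] with probability [1 - r i]. *)
Lemma chi_tail_le i l m :
  (P [set p | forall j, (l <= j)%N -> ~ formulas_of p (at_var j (chi i))] <=
   ((1 - r i) ^+ m.+1)%:E)%E.
Proof.
pose k := (l + m)%N.
pose f : pformula U 'I_k.+1 := FNot (FImps [seq j : 'I_k.+1 <- enum 'I_k.+1 | (l <= j)%N]
  (fun j => FNot (at_var j (chi i))) FBot).
have mZ := measurable_chi_tail i l.
apply: (@le_trans _ _ (P (clopen_of (in_seq f)))).
  apply: le_measure; [exact: mem_set mZ|apply: mem_set|].
    exact: (@measurable_formula L U nat (in_seq f)).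
  move=> p /= pZ; rewrite /clopen_of /= in_seq_FNot; apply/global_type_FNot; rewrite in_seq_FImps => pf.
  apply: (@global_type_FBot _ _ _ p); apply: pf => j; rewrite mem_filter => /andP[lj _].
  rewrite in_seq_FNot in_seq_at_var.
  by apply/global_type_FNot; exact: pZ.
rewrite P_mu.2 lee_fin.
(* [g] is [r] with the letter [i] given weight 0 from place [l] on, so that the sum over words
   factors into one sum per place. *)
pose g (j : 'I_k.+1) i' := if (l <= j)%N && (i' == i) then 0 else r i'.
apply: (@le_trans _ _ (\sum_(w : {ffun 'I_k.+1 -> 'I_n}) \prod_(j < k.+1) g j (w j))).
  apply: ler_sum => w _; case: asboolP => [fw|_]; last first.
    by rewrite mulr0; apply: prodr_ge0 => j _; rewrite /g; case: ifP.
  have [A [b [Achi bw bchi _]]] := word_realized_chi w.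
  have Af : Defs.over A f.
    rewrite /Defs.over /f /=; split=> //; apply: free_vars_in_FImps => // j'.
    by split=> //; exact: over_at_var.
  have fb : psat f b := (bw f Af).1 fw.
  rewrite mulr1; apply: ler_prod => j _; rewrite r_ge0 /g.
  case: ifP => [/andP[lj /eqP wji]|_]; last by rewrite lexx.
  have je : j \in [seq j : 'I_k.+1 <- enum 'I_k.+1 | (l <= j)%N].
    by rewrite mem_filter lj mem_enum.
  exfalso; apply: fb; apply/sat_FImps => /(_ j je).
  by apply; apply/psat_at_var/bchi; rewrite wji.
rewrite -(bigA_distr_bigA g) -(prod_tail _ l) /= addnS.
apply: ler_prod => j _; rewrite sumr_ge0 => [|i' _]; last by rewrite /g; case: ifP.
rewrite /g; case: (leqP l j) => lj /=; last by rewrite r_sum.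
rewrite -r_sum [in leRHS](bigD1 i)//= addrAC subrr add0r.
rewrite (bigD1 i)//= eqxx add0r; apply: ler_sum => i' /negPf->//.
Qed.

Lemma ae_chi_infinite i l : 0 < r i -> \forall p \ae P,
  exists2 j, (l <= j)%N & formulas_of (p : global_type U nat) (at_var j (chi i)).
Proof.
move=> ri.
exists [set p | forall j, (l <= j)%N -> ~ formulas_of p (at_var j (chi i))]; split.
- exact: measurable_chi_tail.
- apply/eqP; rewrite eq_le measure_ge0 andbT.
  have ri1 : r i <= 1.
    by rewrite -r_sum (bigD1 i)//= lerDl; exact: sumr_ge0.
  have : (GRing.exp (1 - r i) : R ^nat) @ \oo --> 0.
    by apply: cvg_expr; rewrite ger0_norm ?subr_ge0// ltrBlDr ltrDl.
  move=> /cvgrPdist_lt c0; apply/lee_addgt0Pr => e e0; rewrite add0e.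
  have [m _ /(_ m.+1 (leqnSn m))] := c0 e e0.
  rewrite sub0r normrN ger0_norm ?exprn_ge0 ?subr_ge0// => /ltW me.
  by apply: le_trans (chi_tail_le i l m) _; rewrite lee_fin.
- move=> p /= np j lj pj; apply: np; by exists j.
Qed.

Lemma ae_eq_in i j : i <> j -> \forall p \ae P, ~ eq_in (p : global_type U nat) i j.
Proof.
move=> ij; pose k := maxn i j.
have ik : (i < k.+1)%N by rewrite ltnS leq_maxl.
have jk : (j < k.+1)%N by rewrite ltnS leq_maxr.
have : \forall p \ae P, formulas_of (p : global_type U nat)
    (in_seq (FNot (FEq (inl (Ordinal ik)) (inl (Ordinal jk))))).
  apply: ae_in_seq => w wpos; have [A [b [_ bw _ binj]]] := word_realized_chi w.
  by apply/bw => //= /(binj wpos)[].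
by apply: filterS => p /global_type_FNot.
Qed.

(** [g] is whichever of [f] and its negation holds for [w]. The implication [h] holds for every word
    [w'] of positive colors: if its premises hold, [w'] and [w] name the same types and have the
    same product. *)
Lemma ae_word k (w : 'I_k.+1 -> 'I_n) (f : pformula U 'I_k.+1) :
  (forall A, Defs.over A f) -> \forall p \ae P,
  (forall j, formulas_of (p : global_type U nat) (at_var (nat_of_ord j) (chi (w j)))) ->
  formulas_of p (in_seq f) <-> word w f.
Proof.
move=> fover; pose g := if pselect (word w f) then f else FNot f.
pose h := FImps (enum 'I_k.+1) (fun j => at_var j (chi (w j))) g.
have : \forall p \ae P, formulas_of (p : global_type U nat) (in_seq h).
  apply: ae_in_seq => w' w'pos; have [A [b [Achi bw bchi _]]] := word_realized_chi w'.
  have Ag : Defs.over A g by rewrite /g; case: pselect => _ /=; [|split=> //]; exact: fover.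
  apply/bw; first by apply: free_vars_in_FImps => // j; exact: over_at_var.
  apply/sat_FImps => bh; have ww' : word w' = word w.
    congr (iterated_morley K M); apply: funext => j; apply: chi_sep.
    by apply/bchi/psat_at_var/bh; rewrite mem_enum.
  rewrite -/(psat g b) /g; case: pselect => [wf|nwf]; first by apply/bw => //; rewrite ww'.
  by move=> fb; apply: nwf; rewrite -ww'; apply/bw.
apply: filterS => p /in_seq_FImps ph pchi.
have : formulas_of p (in_seq g).
  apply: ph => j _; rewrite in_seq_at_var; exact: pchi.
rewrite /g; case: pselect => [wf|nwf]; first by [].
by move=> /global_type_FNot.
Qed.

Lemma ae_imp (A : Prop) (Q : global_type U nat -> Prop) :
  (A -> \forall p \ae P, Q p) -> \forall p \ae P, A -> Q p.
Proof.
have [a /(_ a)|na _] := EM A; last exact: aeW.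
by apply: filterS => p Qp _.
Qed.

Lemma ae_generic_word : \forall p \ae P, exists w, generic_word p w.
Proof.
have cnat : countable [set: nat] by exact: countableP.
have cord : countable [set: 'I_n] by exact: countableP.
have h1 := ae_forall_countable cnat ae_chi_cover.
have h2 := ae_forall_countable cnat (fun j => ae_forall_countable cord (fun i =>
  ae_forall_countable cord (fun i' => ae_imp (@ae_chi_unique j i i')))).
have h3 := ae_forall_countable cord (fun i => ae_forall_countable cnat (fun l =>
  ae_imp (@ae_chi_infinite i l))).
have h4 := ae_forall_countable cnat (fun i => ae_forall_countable cnat (fun j =>
  ae_imp (@ae_eq_in i j))).
(* Words and tuples are taken as finite functions so that the quantifiers range over countable
   types. *)
have h5 : \forall p \ae P, forall k (w : {ffun 'I_k.+1 -> 'I_n}) s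
    (a : {ffun 'I_(arity s) -> 'I_k.+1}),
    (forall j, formulas_of (p : global_type U nat) (at_var (nat_of_ord j) (chi (w j)))) ->
    formulas_of p (in_seq (FRel s (inl \o a))) <-> word w (FRel s (inl \o a)).
  apply: ae_forall_countable => [//|k].
  apply: ae_forall_countable => [|w]; first exact: countableP.
  apply: ae_forall_countable => [//|s].
  apply: ae_forall_countable => [|a]; first exact: countableP.
  exact: ae_word.
apply: filterS (filterI h1 (filterI h2 (filterI h3 (filterI h4 h5)))).
move=> p [/choice[w wP] [p2 [p3 [p4 p5]]]]; exists w; split.
- by move=> j; have [] := wP j.
- move=> i ri l; have [j lj pj] := p3 i l ri; exists j => //.
  (* Both [chi i] and [chi (w j)] hold at place [j], so by uniqueness of the color the two types are
     equal. *)
  apply: contrapT => wji; apply: (p2 j _ _ wji); split=> //.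
  by have [] := wP j.
- by move=> i j eij; apply: contrapT => /p4.
move=> k s a.
have := p5 k [ffun j : 'I_k.+1 => w j] s (finfun a).
rewrite (_ : (finfun a : 'I_(arity s) -> 'I_k.+1) = a); last first.
  by apply: funext => x; rewrite ffunE.
rewrite (_ : ([ffun j : 'I_k.+1 => w j] : 'I_k.+1 -> 'I_n) = fun j => w j); last first.
  by apply: funext => x; rewrite ffunE.
by apply=> j; have [] := wP j.
Qed.

End MorleyMeasure.

(** * An isomorphism class of full measure *)

Theorem theorem4p7 (R : realType) (L : language)
  (L_countable : countable [set: rel_symbol L])
  (T : theory L) (T_complete : complete_theory T)
  (U : structure L) (U_T : models U T)
  (K : Type) (U_monster : monster_model K U)
  (M : set U) (M_small : small K M) (M_elem : elementary_substructure M)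
  (n : nat) (q : 'I_n -> global_type U unit) (r : 'I_n -> R)
  (q_inv : forall i, invariant_type M (q i))
  (r_ge0 : forall i, 0 <= r i)
  (r_sum : \sum_(i < n) r i = 1)
  (q_comm : forall i j, morley_commute K M (q i) (q j))
  (no_points : forall a : U, mixture r q (clopen_of (FEq (inl tt) (inr a))) = 0%E)
  (P : probability (borel (global_type U nat)) R)
  (P_mu : morley_measure K M r q P) :
  exists N : structure L,
    measurable (B_ U N : set (borel (global_type U nat))) /\ P (B_ U N) = 1%E.
Proof.
have [K_unc U_sat _] := U_monster; have [M0 _] := M_elem.
(* A realized [q i] of positive weight would give the point [u] positive mass. *)
have q_nonrealized i : 0 < r i -> forall u, ~ formulas_of (q i) (FEq (inl tt) (inr u)).
  move=> ri u qiu; have := no_points u; rewrite /mixture => /eqP.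
  rewrite seq_psume_eq0 => [|j _]; last by rewrite mule_ge0 ?lee_fin.
  move=> /allP/(_ i); rewrite mem_index_enum => /(_ isT)/=.
  by rewrite diracE mem_set// mule1 eqe gt_eqF.
have [chi [chi_q chi_sep]] := separating_formulas q.
have gw := ae_generic_word L_countable K_unc U_sat M_small M0 q_inv r_ge0 r_sum q_comm
  q_nonrealized P_mu chi_q chi_sep.
(* An almost sure event of a probability measure is not empty. *)
have [p [w pw]] : exists p w, generic_word K M q r p w.
  apply: contrapT => np; have : P.-negligible setT.
    by apply: negligibleS gw => p _ /= wp; apply: np; exists p.
  move=> /(negligibleP P measurableT) PT.
  by have /eqP := etrans (esym (probability_setT P)) PT; rewrite onee_eq0.
pose N := @Structure L nat (@rel_in L U p) (ex_intro _ 0%N I).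
have mB : measurable (B_ U N : set (borel (global_type U nat))).
  exact: (generic_word_measurable_B L_countable K_unc U_sat M_small M0 q_inv q_comm pw).
exists N; split=> //.
(* Every generic type induces the same structure as [p] up to isomorphism, so the complement
   consists of non-generic types. *)
have : P (~` B_ U N) = 0%E.
  apply/(negligibleP P (measurableC mB)); apply: negligibleS gw => p' nB [w' p'w']; apply: nB.
  exact: (generic_word_coded K_unc U_sat M_small M0 q_inv q_comm p'w' pw).
rewrite probability_setC// => /eqP; rewrite sube_eq ?fin_num_measure//.
by rewrite add0e => /eqP.
Qed.
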